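(* Let $(V,E)$ be a rooted directed tree with root $r$ and let $\mu=(\mu_v)_{v\in V}$ be a weight on $V$. Let $X=\ell^p(V,\mu)$, $1\leq p<+\infty$, or $X=c_0(V,\mu)$, and suppose that the backward shift $B$ is a bounded operator on $X$. The following conditions are equivalent: (1) $B$ has an orbit with a nonzero limit point. (2) $B$ has an orbit with a nonzero weak limit point. (3) $B$ has an orbit with $e_r$ as a limit point. (4) $B$ has an orbit with $e_r$ as a weak limit point. (5) There are an increasing sequence $(n_k)_k$ of positive integers and a vertex $v\in V$ such that, as $k\to+\infty$, $$\begin{cases}\sum_{u\in\mathrm{Chi}^{n_k}(v)}\dfrac{1}{|\mu_u|^{p^\ast}}\longrightarrow+\infty & \text{if } X=\ell^p(V,\mu),\ 1<p<+\infty;\\[2mm] \inf_{u\in\mathrm{Chi}^{n_k}(v)}|\mu_u|\longrightarrow0 & \text{if } X=\ell^1(V,\mu);\\[2mm] \sum_{u\in\mathrm{Chi}^{n_k}(v)}\dfrac{1}{|\mu_u|}\longrightarrow+\infty & \text{if } X=c_0(V,\mu).\end{cases}$$ (6) There is an increasing sequence $(n_k)_k$ of positive integers such that, as $k\to+\infty$, $$\begin{cases}\sum_{u\in\mathrm{Chi}^{n_k}(r)}\dfrac{1}{|\mu_u|^{p^\ast}}\longrightarrow+\infty & \text{if } X=\ell^p(V,\mu),\ 1<p<+\infty;\\[2mm] \inf_{u\in\mathrm{Chi}^{n_k}(r)}|\mu_u|\longrightarrow0 & \text{if } X=\ell^1(V,\mu);\\[2mm] \sum_{u\in\mathrm{Chi}^{n_k}(r)}\dfrac{1}{|\mu_u|}\longrightarrow+\infty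 & \text{if } X=c_0(V,\mu).\end{cases}$$ (7) There exist an increasing sequence $(n_k)_{k}$ of positive integers and a vertex $v\in V$ such that, for any $l\in\mathbb{N}_0$, as $k\to+\infty$, $$\begin{cases}\sum_{u\in\mathrm{Chi}^{n_k+l}(v)}\dfrac{1}{|\mu_u|^{p^\ast}}\longrightarrow+\infty & \text{if } X=\ell^p(V,\mu),\ 1<p<+\infty;\\[2mm] \inf_{u\in\mathrm{Chi}^{n_k+l}(v)}|\mu_u|\longrightarrow0 & \text{if } X=\ell^1(V,\mu);\\[2mm] \sum_{u\in\mathrm{Chi}^{n_k+l}(v)}\dfrac{1}{|\mu_u|}\longrightarrow+\infty & \text{if } X=c_0(V,\mu).\end{cases}$$
   Context: $\mathbb{N}_0=\{0,1,2,\ldots\}$, $\mathbb{K}$ is $\mathbb{R}$ or $\mathbb{C}$. Directed tree: a pair $(V,E)$ with $V$ a non-empty countable set (vertices) and $E\subset\{(u,v):u,v\in V,u\neq v\}$ (edges) such that: (i) any two distinct vertices are joined by an undirected path; (ii) there is no circuit, i.e. no sequence $v_1,\ldots,v_n$ of distinct vertices, $n\geq2$, with $(v_j,v_{j+1})\in E$ for $1\le j<n$ and $(v_n,v_1)\in E$; (iii) for each $v\in V$ there is at most one $u\in V$ with $(u,v)\in E$; if it exists it is called the parent of $v$, denoted $\mathrm{par}(v)$. A root is a vertex without parent (there is at most one); the tree is rooted if it has a root. $\mathrm{Chi}(v)=\{u\in V:\mathrm{par}(u)=v\}$, $\mathrm{Chi}^1(v)=\mathrm{Chi}(v)$, $\mathrm{Chi}^n(v)=\bigcup_{u\in\mathrm{Chi}(v)}\mathrm{Chi}^{n-1}(u)$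 for $n\geq2$. Weight on $V$: a family $\mu=(\mu_v)_{v\in V}$ of non-zero numbers in $\mathbb{K}$. $\ell^p(V,\mu)=\{f\in\mathbb{K}^V:\|f\|_{p,\mu}^p=\sum_{v}|f(v)\mu_v|^p<+\infty\}$ with norm $\|\cdot\|_{p,\mu}$; $c_0(V,\mu)$ is the set of $f\in\mathbb{K}^V$ such that for every $\varepsilon>0$ there is a finite $F\subset V$ with $|f(v)\mu_v|<\varepsilon$ for all $v\in V\setminus F$, with norm $\sup_v|f(v)\mu_v|$. For $1<p<\infty$, $p^\ast=p/(p-1)$. $e_v$ is the characteristic function of $\{v\}$. The backward shift is $(Bf)(v)=\sum_{u\in\mathrm{Chi}(v)}f(u)$. An empty sum is $0$, the infimum of the empty set is $+\infty$; sums of non-negative numbers may equal $+\infty$. Increasing sequences of integers are strictly increasing. An orbit of $B$ is a set $\{B^nf:n\in\mathbb{N}_0\}$ with $f\in X$; limit point (resp. weak limit point) of an orbit means accumulation point of this set for the norm (resp. weak) topology of $X$. *)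

(* Defs.v *)
From HB Require Import structures.
From mathcomp Require Import all_boot all_order all_algebra.
From mathcomp Require Import complex ring.
From mathcomp Require Import all_classical all_reals all_analysis.

Set Implicit Arguments.
Unset Strict Implicit.
Unset Printing Implicit Defensive.

Import Order.TTheory GRing.Theory Num.Theory.
Import numFieldNormedType.Exports.

Local Open Scope classical_set_scope.
Local Open Scope ring_scope.

Record directed_tree (V : countType) (E : rel V) : Prop := DirectedTree {
  edge_neq : forall u v, E u v -> u != v;
  tree_connected : forall u v, u != v ->
    exists s : seq V, path (fun x y => E x y || E y x) u s /\ last u s = v;
  tree_acyclic : forall c : seq V, (2 <= size c)%N -> uniq c -> ~~ cycle E c;
  parent_unique : forall u u' v, E u v -> E u' v -> u = u'
}.

Definition is_root (V : countType) (E : rel V) (r : V) : Prop :=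
  forall u, ~~ E u r.

(* In a directed tree, [E v u] says precisely that [v] is the parent of [u]. *)
Definition Chi (V : countType) (E : rel V) (v : V) : set V := [set u | E v u].

(* For n >= 1 this is Chi^n(v); the value [set v] at n = 0 is a convention. *)
Fixpoint Chin (V : countType) (E : rel V) (n : nat) (v : V) : set V :=
  if n is n'.+1 then \bigcup_(u in Chi E v) Chin E n' u else [set v].

Lemma Chin1 (V : countType) (E : rel V) (v : V) : Chin E 1 v = Chi E v.
Proof.
by rewrite /=; apply/seteqP; split => [u [w vw ->]//|u vu]; exists u.
Qed.

Variant scalar_field := RealScalars | ComplexScalars.

Definition scalar (R : realType) (k : scalar_field) : numFieldType :=
  match k with
  | RealScalars => R
  | ComplexScalars => complex R
  end.

(* The modulus as an element of R; the library norm of the scalar field takes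
   its values in the field itself. *)
Definition modulus (R : realType) (k : scalar_field) : scalar R k -> R :=
  match k with
  | RealScalars => fun x : R => `|x|
  | ComplexScalars => fun z : complex R => complex.Re `|z|
  end.

Definition of_real (R : realType) (k : scalar_field) : R -> scalar R k :=
  match k with
  | RealScalars => fun x : R => x
  | ComplexScalars => fun x : R => Complex x 0
  end.
Arguments of_real {R} k x.

Section scalar_theory.
Context (R : realType) (k : scalar_field).
Implicit Types (x y : scalar R k) (a b : R).

Lemma of_real_modulus x : of_real k (modulus x) = `|x|.
Proof.
move: x; rewrite /of_real /modulus /scalar; case: k => [//|z].
by rewrite normc_def.
Qed.

Lemma of_realD a b : of_real k (a + b) = of_real k a + of_real k b.
Proof.
rewrite /of_real /scalar; case: k; first by [].
exact: (rmorphD (real_complex R)).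
Qed.

Lemma of_realM a b : of_real k (a * b) = of_real k a * of_real k b.
Proof.
rewrite /of_real /scalar; case: k; first by [].
exact: (rmorphM (real_complex R)).
Qed.

Lemma of_real_le a b : (of_real k a <= of_real k b) = (a <= b).
Proof. rewrite /of_real /scalar; case: k; [by []|exact: lecR]. Qed.

Lemma of_real0 : of_real k 0 = 0 :> scalar R k.
Proof. by rewrite /of_real /scalar; case: k. Qed.

Lemma of_real_inj : injective (of_real k : R -> scalar R k).
Proof. by move=> a b ab; apply/le_anti; rewrite -!of_real_le ab lexx. Qed.

Lemma modulus_ge0 x : 0 <= modulus x.
Proof. by rewrite -(of_real_le 0) of_real0 of_real_modulus. Qed.

Lemma modulus0 : modulus (0 : scalar R k) = 0.
Proof. by apply: of_real_inj; rewrite of_real_modulus normr0 of_real0. Qed.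

Lemma modulus_eq0 x : modulus x = 0 -> x = 0.
Proof.
by move=> x0; apply/normr0_eq0; rewrite -of_real_modulus x0 of_real0.
Qed.

Lemma modulusM x y : modulus (x * y) = modulus x * modulus y.
Proof. by apply: of_real_inj; rewrite of_realM !of_real_modulus normrM. Qed.

Lemma modulusD x y : modulus (x + y) <= modulus x + modulus y.
Proof. by rewrite -of_real_le of_realD !of_real_modulus ler_normD. Qed.

End scalar_theory.

Variant seq_space (R : realType) :=
  | Lp (p : R) of 1 <= p
  | C0.
Arguments C0 {R}.

Record weight (R : realType) (k : scalar_field) (V : countType) := Weight {
  weight_fun :> V -> scalar R k;
  weight_neq0 : forall v, weight_fun v != 0
}.

(* Membership and norm only depend on the family a_v = |f(v) mu_v|. *)
Definition in_space (R : realType) (V : countType) (X : seq_space R)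
    (a : V -> R) : Prop :=
  match X with
  | Lp p _ => (\esum_(v in [set: V]) (a v `^ p)%:E < +oo)%E
  | C0 => forall e, 0 < e ->
      exists2 F : set V, finite_set F & forall v, ~ F v -> a v < e
  end.

Definition space_norm (R : realType) (V : countType) (X : seq_space R)
    (a : V -> R) : R :=
  match X with
  | Lp p _ => (fine (\esum_(v in [set: V]) (a v `^ p)%:E)) `^ p^-1
  | C0 => sup (range a)
  end.

Section space_theory.
Context (R : realType) (V : countType).
Implicit Types (a b c : V -> R) (X : seq_space R) (p : R).

Local Notation nneg a := (forall v, 0 <= a v).

Lemma pesum_ge0 p a : (0 <= \esum_(v in [set: V]) (a v `^ p)%:E)%E.
Proof. by apply: esum_ge0 => v _; rewrite lee_fin powR_ge0. Qed.

Lemma pesum_le p a b : 0 <= p -> nneg a -> (forall v, a v <= b v) ->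
  (\esum_(v in [set: V]) (a v `^ p)%:E <=
   \esum_(v in [set: V]) (b v `^ p)%:E)%E.
Proof.
move=> p0 a0 ab; apply: le_esum => v _; rewrite lee_fin.
by apply: ge0_ler_powR => //; rewrite nnegrE// (le_trans (a0 v)).
Qed.

Lemma esumZ_le (x : R) a : 0 <= x -> nneg a ->
  (\esum_(v in [set: V]) (x * a v)%:E <=
   x%:E * \esum_(v in [set: V]) (a v)%:E)%E.
Proof.
move=> x0 a0; apply: ge_ereal_sup => _ [F [Ffin FT] <-].
have -> : (\sum_(v \in F) (x * a v)%:E = x%:E * \sum_(v \in F) (a v)%:E)%E.
  by rewrite ge0_mule_fsumr// => v; rewrite lee_fin.
by apply: lee_wpmul2l; rewrite ?lee_fin//; apply: esum_ge; exists F.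
Qed.

Lemma pesumE p a : 1 <= p -> (\esum_(v in [set: V]) (a v `^ p)%:E < +oo)%E ->
  \esum_(v in [set: V]) (a v `^ p)%:E =
  ((fine (\esum_(v in [set: V]) (a v `^ p)%:E)) `^ p^-1 `^ p)%:E.
Proof.
move=> p1 afin; have p0 : p != 0 by rewrite gt_eqF// (lt_le_trans ltr01).
rewrite -powRrM mulVf// powRr1 ?fine_ge0 ?pesum_ge0//.
by rewrite fineK// ge0_fin_numE// pesum_ge0.
Qed.

Lemma pnorm_le p a (C : R) : 1 <= p -> 0 <= C ->
  (\esum_(v in [set: V]) (a v `^ p)%:E <= (C `^ p)%:E)%E ->
  (fine (\esum_(v in [set: V]) (a v `^ p)%:E)) `^ p^-1 <= C.
Proof.
move=> p1 C0 aC; have p0 : 0 < p by rewrite (lt_le_trans ltr01).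
have -> : C = (C `^ p) `^ p^-1.
  by rewrite -powRrM mulfV ?powRr1// lt0r_neq0.
apply: ge0_ler_powR; rewrite ?nnegrE ?invr_ge0 ?fine_ge0 ?pesum_ge0 ?powR_ge0//.
  exact: ltW.
rewrite -lee_fin fineK// ge0_fin_numE ?pesum_ge0//.
exact: le_lt_trans aC (ltry _).
Qed.

Lemma powR_convex p (A B x y : R) : 1 <= p -> 0 < A -> 0 < B ->
  0 <= x -> 0 <= y ->
  (x + y) `^ p <=
    (A + B) `^ p * (A / (A + B)) / A `^ p * x `^ p +
    (A + B) `^ p * (B / (A + B)) / B `^ p * y `^ p.
Proof.
move=> p1 A0 B0 x0 y0; have AB0 : 0 < A + B by rewrite addr_gt0.
have t0 : 0 <= A / (A + B) by rewrite divr_ge0// ltW.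
have t1 : A / (A + B) <= 1 by rewrite ler_pdivrMr// mul1r lerDl ltW.
have sE : 1 - A / (A + B) = B / (A + B).
  by rewrite -[X in X - _](divff (lt0r_neq0 AB0)) -mulrBl addrAC subrr add0r.
have xA : 0 <= x / A by rewrite divr_ge0// ltW.
have yB : 0 <= y / B by rewrite divr_ge0// ltW.
have H : (A / (A + B) * (x / A) + B / (A + B) * (y / B)) `^ p <=
    A / (A + B) * (x / A) `^ p + B / (A + B) * (y / B) `^ p.
  have := @convex_powR R p p1 (Itv01 t0 t1) (x / A) (y / B).
  rewrite !inE/= !in_itv/= !andbT => /(_ xA yB).
  by rewrite -sE.
have -> : x + y = (A + B) * (A / (A + B) * (x / A) + B / (A + B) * (y / B)).
  by field; rewrite !lt0r_neq0.
have q0 : 0 <= A / (A + B) * (x / A) + B / (A + B) * (y / B).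
  by rewrite addr_ge0// mulr_ge0// divr_ge0// ltW.
rewrite powRM ?(ltW AB0)//.
apply: le_trans (ler_wpM2l (powR_ge0 _ _) H) _.
have pV (z C : R) : 0 <= z -> 0 < C -> (z / C) `^ p = z `^ p / C `^ p.
  move=> z0 C0; rewrite powRM ?invr_ge0 ?(ltW C0)//.
  by rewrite -(powR_inv1 (ltW C0)) -powRrM mulN1r powRN.
rewrite !pV// mulrDr !mulrA le_eqVlt; apply/orP; left; apply/eqP.
by congr (_ + _); rewrite -!mulrA; do 3 congr (_ * _); rewrite mulrC.
Qed.

Lemma minkowski_esum p a b (A B : R) : 1 <= p -> 0 < A -> 0 < B ->
  nneg a -> nneg b ->
  (\esum_(v in [set: V]) (a v `^ p)%:E <= (A `^ p)%:E)%E ->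
  (\esum_(v in [set: V]) (b v `^ p)%:E <= (B `^ p)%:E)%E ->
  (\esum_(v in [set: V]) ((a v + b v) `^ p)%:E <= ((A + B) `^ p)%:E)%E.
Proof.
move=> p1 A0 B0 a0 b0 aA bB; have AB0 : 0 < A + B by rewrite addr_gt0.
set cA := (A + B) `^ p * (A / (A + B)) / A `^ p.
set cB := (A + B) `^ p * (B / (A + B)) / B `^ p.
have cA0 : 0 <= cA.
  by rewrite /cA !mulr_ge0 ?invr_ge0 ?powR_ge0// ?invr_ge0 ltW.
have cB0 : 0 <= cB.
  by rewrite /cB !mulr_ge0 ?invr_ge0 ?powR_ge0// ?invr_ge0 ltW.
have -> : (A + B) `^ p = cA * A `^ p + cB * B `^ p.
  rewrite /cA /cB !divfK ?lt0r_neq0 ?powR_gt0//.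
  by rewrite -mulrDr -mulrDl divff ?mulr1// lt0r_neq0.
have H : (\esum_(v in [set: V]) ((a v + b v) `^ p)%:E <=
    \esum_(v in [set: V]) ((cA * a v `^ p)%:E + (cB * b v `^ p)%:E))%E.
  by apply: le_esum => v _; rewrite -EFinD lee_fin; exact: powR_convex.
apply: le_trans H _; rewrite esumD; first last.
- by move=> v _; rewrite lee_fin mulr_ge0// powR_ge0.
- by move=> v _; rewrite lee_fin mulr_ge0// powR_ge0.
rewrite EFinD !EFinM; apply: leeD.
- apply: le_trans (esumZ_le cA0 (fun v => powR_ge0 _ _)) _.
  by apply: lee_wpmul2l; rewrite ?lee_fin.
- apply: le_trans (esumZ_le cB0 (fun v => powR_ge0 _ _)) _.
  by apply: lee_wpmul2l; rewrite ?lee_fin.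
Qed.

Lemma C0_has_ubound a : in_space C0 a -> has_ubound (range a).
Proof.
move=> /(_ 1 ltr01) [F Ffin Fa].
exists (\big[Order.max/1]_(v <- finmap.enum_fset (fset_set F)) a v) => _ [v _ <-].
have [Fv|Fv] := pselect (F v); last first.
  by apply: le_trans (ltW (Fa v Fv)) _; exact: bigmax_ge_id.
by apply: le_bigmax_seq => //; rewrite in_fset_set// inE.
Qed.

Lemma space_norm_ge0 X a : nneg a -> 0 <= space_norm X a.
Proof.
case: X => [p p1|] a0 /=; first exact: powR_ge0.
have [[[_ [v _ _]] ub]|ns] := pselect (has_sup (range a)); last first.
  by rewrite sup_out.
by apply: le_trans (a0 v) _; apply: ub_le_sup => //; exists v.
Qed.

Lemma in_space0 X : in_space X (fun _ : V => 0).
Proof.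
case: X => [p p1|] /=; last by move=> e e0; exists set0.
rewrite esum1// => v _; rewrite powR0// gt_eqF//.
exact: lt_le_trans p1.
Qed.

Lemma in_space1 X a (w : V) : nneg a -> (forall v, v != w -> a v = 0) ->
  in_space X a.
Proof.
move=> a0 aw; case: X => [p p1|] /=; last first.
  by move=> e e0; exists [set w] => // v /eqP vw; rewrite aw.
have -> : \esum_(v in [set: V]) (a v `^ p)%:E =
    \esum_(v in [set w]) (a v `^ p)%:E.
  rewrite [RHS]esum_mkcond; apply: eq_esum => v _.
  case: ifPn => //; rewrite notin_setE/= => /eqP vw.
  by rewrite aw// powR0// gt_eqF// (lt_le_trans ltr01).
by rewrite esum_set1 ?ltry// lee_fin powR_ge0.
Qed.

Lemma in_spaceD X a b c : nneg a -> nneg b -> nneg c ->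
  (forall v, c v <= a v + b v) ->
  in_space X a -> in_space X b -> in_space X c.
Proof.
move=> a0 b0 c0 cab; case: X => [p p1|] /= sa sb.
  have p0 : 0 <= p by rewrite (le_trans ler01).
  apply: le_lt_trans (pesum_le p0 c0 cab) _.
  have E (d : V -> R) : nneg d ->
      (\esum_(v in [set: V]) (d v `^ p)%:E < +oo)%E ->
      (\esum_(v in [set: V]) (d v `^ p)%:E <=
       (((fine (\esum_(v in [set: V]) (d v `^ p)%:E)) `^ p^-1 + 1) `^ p)%:E)%E.
    move=> d0 sd; rewrite {1}pesumE// lee_fin.
    by apply: ge0_ler_powR; rewrite ?nnegrE ?addr_ge0 ?powR_ge0// lerDl.
  by apply: le_lt_trans (minkowski_esum p1 _ _ a0 b0 (E _ a0 sa) (E _ b0 sb))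
    (ltry _); rewrite ltr_wpDl ?powR_ge0.
move=> e e0; have e20 : 0 < e / 2 by rewrite divr_gt0.
have [F Ffin Fa] := sa _ e20; have [G Gfin Gb] := sb _ e20.
exists (F `|` G); first by rewrite finite_setU.
move=> v /not_orP[Fv Gv]; apply: le_lt_trans (cab v) _.
by rewrite [ltRHS]splitr ltrD ?Fa ?Gb.
Qed.

Lemma space_normD X a b c : nneg a -> nneg b -> nneg c ->
  (forall v, c v <= a v + b v) -> in_space X a -> in_space X b ->
  space_norm X c <= space_norm X a + space_norm X b.
Proof.
move=> a0 b0 c0 cab; case: X => [p p1|] sa sb.
  have EA := pesumE p1 sa; have EB := pesumE p1 sb; rewrite /space_norm.
  have Age : 0 <= (fine (\esum_(v in [set: V]) (a v `^ p)%:E)) `^ p^-1.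
    exact: powR_ge0.
  have Bge : 0 <= (fine (\esum_(v in [set: V]) (b v `^ p)%:E)) `^ p^-1.
    exact: powR_ge0.
  move: (_ `^ p^-1) EA Age => A EA Age; move: (_ `^ p^-1) EB Bge => B EB Bge.
  apply/ler_addgt0Pr => e e0; have e20 : 0 < e / 2 by rewrite divr_gt0.
  have A0 : 0 < A + e / 2 by rewrite ltr_wpDl.
  have B0 : 0 < B + e / 2 by rewrite ltr_wpDl.
  have -> : A + B + e = A + e / 2 + (B + e / 2) by rewrite addrACA -splitr.
  have p0 : 0 <= p by rewrite (le_trans ler01).
  apply: pnorm_le => //; first by rewrite addr_ge0// ltW.
  apply: le_trans (pesum_le p0 c0 cab) _.
  apply: minkowski_esum => //.
  - rewrite EA lee_fin ge0_ler_powR ?nnegrE// ?(ltW A0)//.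
    by rewrite lerDl ltW.
  - rewrite EB lee_fin ge0_ler_powR ?nnegrE// ?(ltW B0)//.
    by rewrite lerDl ltW.
have [[w _]|V0] := pselect (exists w : V, True); last first.
  have E (d : V -> R) : range d = set0.
    by rewrite -subset0 => t [w _ _]; case: V0; exists w.
  by rewrite /= !E sup0 addr0.
apply: ge_sup; first by exists (c w), w.
move=> _ [v _ <-]; apply: le_trans (cab v) _.
by apply: lerD; apply: ub_le_sup; [exact: C0_has_ubound|exists v
  |exact: C0_has_ubound|exists v].
Qed.

Lemma in_spaceZ X a c (l : R) : 0 <= l -> nneg a ->
  (forall v, c v = l * a v) -> in_space X a -> in_space X c.
Proof.
move=> l0 a0 cE; case: X => [p p1|] /= sa.
  have -> : \esum_(v in [set: V]) (c v `^ p)%:E =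
      \esum_(v in [set: V]) (l `^ p * a v `^ p)%:E.
    by apply: eq_esum => v _; rewrite cE powRM.
  apply: le_lt_trans (esumZ_le (powR_ge0 _ _) (fun v => powR_ge0 _ _)) _.
  by rewrite pesumE// -EFinM ltry.
move=> e e0; have l1 : 0 < l + 1 by rewrite ltr_wpDl.
have [F Ffin Fa] := sa _ (divr_gt0 e0 l1).
exists F => // v /Fa; rewrite ltr_pdivlMr// cE; apply: le_lt_trans.
by rewrite mulrC ler_wpM2l// lerDl.
Qed.

Lemma space_normZ_le X a c (l : R) : 0 <= l -> nneg a ->
  (forall v, c v = l * a v) -> in_space X a ->
  space_norm X c <= l * space_norm X a.
Proof.
move=> l0 a0 cE sa; have N0 := space_norm_ge0 X a0.
case: X sa N0 => [p p1|] sa N0.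
  apply: pnorm_le => //; first by rewrite mulr_ge0.
  have -> : \esum_(v in [set: V]) (c v `^ p)%:E =
      \esum_(v in [set: V]) (l `^ p * a v `^ p)%:E.
    by apply: eq_esum => v _; rewrite cE powRM.
  apply: le_trans (esumZ_le (powR_ge0 _ _) (fun v => powR_ge0 _ _)) _.
  by rewrite [X in (_ * X)%E]pesumE// -EFinM powRM.
have [[w _]|V0] := pselect (exists w : V, True); last first.
  have E (d : V -> R) : range d = set0.
    by rewrite -subset0 => t [w _ _]; case: V0; exists w.
  by rewrite /= !E sup0 mulr0.
apply: ge_sup; first by exists (c w), w.
move=> _ [v _ <-]; rewrite cE ler_wpM2l//.
by apply: ub_le_sup; [exact: C0_has_ubound|exists v].
Qed.

Lemma space_normZ X a c (l : R) : 0 <= l -> nneg a ->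
  (forall v, c v = l * a v) -> in_space X a ->
  space_norm X c = l * space_norm X a.
Proof.
move=> l0 a0 cE sa; apply/le_anti; rewrite space_normZ_le//=.
have c0 v : 0 <= c v by rewrite cE mulr_ge0.
have [l00|lp] : 0 = l \/ 0 < l.
  by apply/predU1P; rewrite -le_eqVlt.
  by rewrite -l00 mul0r space_norm_ge0.
rewrite -ler_pdivlMl//; apply: space_normZ_le => //.
- by rewrite invr_ge0.
- by move=> v; rewrite cE mulKf// lt0r_neq0.
- exact: (in_spaceZ l0 a0 cE).
Qed.

Lemma space_norm_eq0 X a : nneg a -> in_space X a -> space_norm X a = 0 ->
  forall v, a v = 0.
Proof.
move=> a0; case: X => [p p1|] /= sa n0 v.
  have p0 : p != 0 by rewrite gt_eqF// (lt_le_trans ltr01).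
  have s0 : \esum_(v in [set: V]) (a v `^ p)%:E = 0%E.
    by rewrite pesumE// n0 powR0.
  apply: (@powR_eq0_eq0 _ _ p); apply/le_anti; rewrite powR_ge0 andbT.
  suff : ((a v `^ p)%:E <= 0)%E by rewrite lee_fin.
  rewrite -s0; apply: esum_ge; exists [set v] => //.
  by rewrite fsbig_set1.
apply/le_anti; rewrite a0 andbT -n0.
by apply: ub_le_sup; [exact: C0_has_ubound|exists v].
Qed.

End space_theory.

Section wspace.
Context (R : realType) (k : scalar_field) (V : countType).
Variables (mu : weight R k V) (X : seq_space R).

Definition weighted (f : V -> scalar R k) (v : V) : R := modulus (f v * mu v).

Definition wspace_pred : {pred V -> scalar R k} :=
  fun f => `[< in_space X (weighted f) >].

Record wspace := WSpace {
  wspace_fun :> V -> scalar R k;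
  _ : wspace_fun \in wspace_pred
}.

HB.instance Definition _ := [isSub for wspace_fun].
HB.instance Definition _ := [Choice of wspace by <:].

Lemma wspace_predP f : reflect (in_space X (weighted f)) (f \in wspace_pred).
Proof. exact: asboolP. Qed.

Lemma weighted_ge0 f v : 0 <= weighted f v.
Proof. exact: modulus_ge0. Qed.

Lemma weightedD (f g : V -> scalar R k) v :
  weighted (f + g) v <= weighted f v + weighted g v.
Proof. by rewrite /weighted mulrDl modulusD. Qed.

Lemma weightedZ (c : scalar R k) (f : V -> scalar R k) v :
  weighted (c *: f) v = modulus c * weighted f v.
Proof. by rewrite /weighted -modulusM mulrA. Qed.

Lemma wspace_submod_closed : submod_closed wspace_pred.
Proof.
split.
  apply/wspace_predP; rewrite (_ : weighted _ = fun=> 0); last first.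
    by apply/funext => v; rewrite /weighted mul0r modulus0.
  exact: in_space0.
move=> c f g /wspace_predP sf /wspace_predP sg; apply/wspace_predP.
apply: (in_spaceD (@weighted_ge0 (c *: f)) (@weighted_ge0 g)) sg.
- exact: weighted_ge0.
- by move=> v; exact: weightedD.
- exact: (in_spaceZ (modulus_ge0 c) (@weighted_ge0 f) (weightedZ c f)).
Qed.

HB.instance Definition _ :=
  GRing.isSubmodClosed.Build _ _ wspace_pred wspace_submod_closed.
HB.instance Definition _ := [SubChoice_isSubLmodule of wspace by <:].

Lemma wspaceP (f : wspace) : in_space X (weighted f).
Proof. by case: f => f fP; apply/wspace_predP. Qed.

Definition wnorm (f : wspace) : scalar R k :=
  of_real k (space_norm X (weighted f)).

Lemma wnormD (f g : wspace) : wnorm (f + g) <= wnorm f + wnorm g.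
Proof.
rewrite /wnorm -of_realD of_real_le.
apply: space_normD; try exact: weighted_ge0; try exact: wspaceP.
by move=> v; exact: weightedD.
Qed.

Lemma wnormZ (c : scalar R k) (f : wspace) : wnorm (c *: f) = `|c| * wnorm f.
Proof.
rewrite /wnorm -of_real_modulus -of_realM; congr of_real.
apply: space_normZ; [exact: modulus_ge0|exact: weighted_ge0| |exact: wspaceP].
by move=> v; exact: weightedZ.
Qed.

Lemma wnorm_eq0 (f : wspace) : wnorm f = 0 -> f = 0.
Proof.
rewrite /wnorm -of_real0 => /of_real_inj.
move=> /(space_norm_eq0 (@weighted_ge0 f) (wspaceP f)) f0.
apply/val_inj/funext => v /=; move: (f0 v) => /modulus_eq0/eqP.
by rewrite mulf_eq0 (negbTE (weight_neq0 mu v)) orbF => /eqP.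
Qed.

HB.instance Definition _ :=
  Lmodule_isNormed.Build (scalar R k) wspace wnormD wnormZ wnorm_eq0.

Lemma basis_subproof (w : V) :
  (fun v => (v == w)%:R : scalar R k) \in wspace_pred.
Proof.
apply/wspace_predP/(@in_space1 _ _ _ _ w) => [v|v /negbTE vw].
  exact: weighted_ge0.
by rewrite /weighted vw mul0r modulus0.
Qed.

Definition basis_vec (w : V) : wspace := WSpace (basis_subproof w).

End wspace.

(* Unordered summation: the net of finite partial sums over A tends to s. *)
Definition has_sum (K : numFieldType) (V : choiceType) (A : set V) (f : V -> K)
    (s : K) : Prop :=
  forall e : K, 0 < e -> exists2 F, fsets A F &
    forall G, fsets A G -> F `<=` G -> `|\sum_(u \in G) f u - s| < e.

Definition is_backward_shift (R : realType) (k : scalar_field) (V : countType)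
    (E : rel V) (mu : weight R k V) (X : seq_space R)
    (B : wspace mu X -> wspace mu X) : Prop :=
  forall (f : wspace mu X) (v : V), has_sum (Chi E v) f (B f v).

Definition bounded_operator (K : numFieldType) (W : normedModType K)
    (T : {linear W -> W}) : Prop :=
  exists M : K, forall f, `|T f| <= M * `|f|.

Definition op_orbit (K : numFieldType) (W : normedModType K) (T : {linear W -> W})
    (f : W) : set W :=
  range (fun n : nat => iter n T f).

Definition topological_dual (K : numFieldType) (W : normedModType K) :=
  {phi : {linear W -> K^o} | continuous (phi : W -> K^o)}.

HB.instance Definition _ (K : numFieldType) (W : normedModType K) :=
  gen_eqMixin (topological_dual W).
HB.instance Definition _ (K : numFieldType) (W : normedModType K) :=
  gen_choiceMixin (topological_dual W).

(* The coarsest topology on W making all continuous functionals continuous. *)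
Definition weak_space (K : numFieldType) (W : normedModType K) :
    topologicalType :=
  initial_topology
    (fun f : W => (fun phi => sval phi f) : {ptws (topological_dual W) -> K}).

Definition weak_limit_point (K : numFieldType) (W : normedModType K)
    (A : set W) : set W :=
  limit_point (A : set (weak_space W)).

(* For Lp p with p != 1, the exponent p / (p - 1) is the conjugate exponent p*.
   The infimum is taken in \bar R, so that over the empty set it is +oo. *)
Definition weight_condition (R : realType) (k : scalar_field) (V : countType)
    (mu : weight R k V) (X : seq_space R) (A : nat -> set V) : Prop :=
  match X with
  | Lp p _ =>
      if p == 1 then
        ereal_inf [set (modulus (mu u))%:E | u in A j] @[j --> \oo] --> 0%E
      else
        \esum_(u in A j) ((modulus (mu u) `^ (p / (p - 1)))^-1)%:E
          @[j --> \oo] --> +oo%E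
  | C0 => \esum_(u in A j) ((modulus (mu u))^-1)%:E @[j --> \oo] --> +oo%E
  end.

(* Main.v *)
Require Import Defs.
From HB Require Import structures.
From mathcomp Require Import all_boot all_order all_algebra.
From mathcomp Require Import complex ring.
From mathcomp Require Import all_classical all_reals all_analysis.

(* The functional f |-> (B^n f)(v) is the summation over Chi^n(v), and condition
   (5) says that its norm tends to infinity along n = n_k.
   If the orbit of f has a weak limit point x with x(v) <> 0, then |(B^n f)(v)|
   is bounded below for infinitely many n, although it only depends on the
   restriction of f to Chi^n(v), whose norm tends to 0 because these sets are
   pairwise disjoint; hence (5), and (6) since v descends from r.
   Conversely, if the norms at r tend to infinity along n_k, there are m_0 < m_1
   < ... and h_k supported in Chi^{m_k}(r) with B^{m_k} h_k = e_r, h_k being so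
   small compared with |B|^{-m_{k-1}} that f = sum_k h_k satisfies
   B^{m_k} f -> e_r; the terms h_j with j < k disappear because B e_r = 0.
   Finally the norm at n + l is at most |B|^l times the norm at n, so it is also
   large at n_k - i for all i at most some i_k -> oo, whence (7). *)

Set Implicit Arguments.
Unset Strict Implicit.
Unset Printing Implicit Defensive.

Import Order.TTheory GRing.Theory Num.Theory.
Import numFieldNormedType.Exports.

Local Open Scope classical_set_scope.
Local Open Scope ring_scope.

(** * Sequence spaces *)

Section esum_seq.
Context (R : realType) (V : choiceType).
Implicit Types (A : set V) (a : V -> \bar R) (s : seq V).
Local Open Scope ereal_scope.

Lemma sum_le_esum A a s : uniq s -> (forall u, u \in s -> A u) ->
  \sum_(u <- s) a u <= \esum_(u in A) a u.
Proof.
move=> us sA; apply: esum_ge; exists [set` s] => //.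
by rewrite (fsbig_seq _ _ us) lexx.
Qed.

Lemma lt_esum_seq A a (x : \bar R) : x < \esum_(u in A) a u ->
  exists s, [/\ uniq s, forall u, u \in s -> A u & x < \sum_(u <- s) a u].
Proof.
move=> /ereal_sup_gt[_ [F [Ffin FA] <-]] xF.
exists (finmap.enum_fset (fset_set F)); split.
- exact: finmap.fset_uniq.
- by move=> u; rewrite in_fset_set// inE => /FA.
- by rewrite -fsbig_finite.
Qed.

Lemma esum_le_seq A a (x : \bar R) :
  (forall s, uniq s -> (forall u, u \in s -> A u) -> \sum_(u <- s) a u <= x) ->
  \esum_(u in A) a u <= x.
Proof.
move=> H; rewrite leNgt; apply/negP => /lt_esum_seq[s [us sA]].
by rewrite ltNge H.
Qed.

End esum_seq.

Section families.
Context (R : realType) (V : countType).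
Implicit Types (a b c : V -> R) (X : seq_space R) (p : R).

Local Notation nneg a := (forall v, 0 <= a v).

Lemma space_norm0 X : space_norm X (fun _ : V => 0) = 0.
Proof.
apply/le_anti; rewrite space_norm_ge0// andbT.
have z0 (v : V) : (0 : R) = 0 * 0 by rewrite mul0r.
have := space_normZ_le (lexx 0) (fun=> lexx 0) z0 (in_space0 V X).
by rewrite mul0r.
Qed.

Lemma in_space_le X a c : nneg c -> (forall v, c v <= a v) ->
  in_space X a -> in_space X c.
Proof.
move=> c0 ca Xa.
have a0 v : 0 <= a v by apply: le_trans (ca v).
apply: (in_spaceD a0 (fun=> lexx 0) c0 _ Xa (in_space0 V X)) => v.
by rewrite addr0.
Qed.

Lemma coord_le_norm X a v : nneg a -> in_space X a -> a v <= space_norm X a.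
Proof.
case: X => [p p1|] a0 /= Xa; last first.
  by apply: ub_le_sup; [exact: C0_has_ubound|exists v].
have p0 : 0 < p by rewrite (lt_le_trans ltr01).
have -> : a v = (a v `^ p) `^ p^-1 by rewrite -powRrM mulfV ?lt0r_neq0// powRr1.
apply: ge0_ler_powR; rewrite ?nnegrE ?invr_ge0 ?powR_ge0 ?fine_ge0 ?pesum_ge0//.
  exact: ltW.
rewrite -lee_fin fineK ?ge0_fin_numE ?pesum_ge0//.
have := @sum_le_esum R V setT (fun v => (a v `^ p)%:E) [:: v].
by rewrite big_seq1; apply.
Qed.

Lemma space_sum X (a : nat -> V -> R) J : (forall j, nneg (a j)) ->
  (forall j, in_space X (a j)) ->
  in_space X (fun v => \sum_(j < J) a j v) /\
  space_norm X (fun v => \sum_(j < J) a j v) <= \sum_(j < J) space_norm X (a j).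
Proof.
move=> a0 Xa; elim: J => [|J [IH1 IH2]].
  under eq_fun do rewrite big_ord0.
  by rewrite big_ord0 space_norm0; split => //; exact: in_space0.
have s0 v : 0 <= \sum_(j < J) a j v by apply: sumr_ge0 => j _; exact: a0.
have s1 v : 0 <= \sum_(j < J.+1) a j v by apply: sumr_ge0 => j _; exact: a0.
have sE v : \sum_(j < J.+1) a j v <= \sum_(j < J) a j v + a J v.
  by rewrite big_ord_recr.
split; first exact: (in_spaceD s0 (a0 J) s1 sE).
rewrite big_ord_recr/=; apply: le_trans (space_normD s0 (a0 J) s1 sE IH1 (Xa J)) _.
by rewrite lerD2r.
Qed.

Lemma space_tail X a (e : R) : nneg a -> in_space X a -> 0 < e ->
  exists2 F : set V, finite_set F & forall c, nneg c ->
    (forall v, c v <= a v) -> (forall v, F v -> c v = 0) -> space_norm X c <= e.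
Proof.
case: X => [p p1|] a0 Xa e0; last first.
  have [F Ffin Fa] := Xa e e0; exists F => // c c0 ca cF.
  have [[w _]|V0] := pselect (exists w : V, True); last first.
    rewrite /= (_ : range c = set0) ?sup0 ?ltW//.
    by rewrite -subset0 => t [w _ _]; case: V0; exists w.
  apply: ge_sup; first by exists (c w), w.
  move=> _ [v _ <-]; have [/cF->|/Fa av] := pselect (F v); first exact: ltW.
  exact: le_trans (ca v) (ltW av).
have p0 : 0 < p by rewrite (lt_le_trans ltr01).
move: Xa => /= Xa; set S := (\esum_(v in [set: V]) (a v `^ p)%:E)%E in Xa *.
have Sfin : S \is a fin_num by rewrite ge0_fin_numE// pesum_ge0.
have : (S - (e `^ p)%:E < S)%E by rewrite lteBlDr// lteDl// lte_fin powR_gt0.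
move=> /lt_esum_seq[s [us _ sS]].
exists [set` s]; first exact: finite_seq.
move=> c c0 ca cs.
apply: pnorm_le => //; first exact: ltW.
apply: esum_le_seq => t ut _.
rewrite (bigID (fun v => v \in s))/= big1 ?add0e; last first.
  by move=> v vs; rewrite cs// powR0// gt_eqF.
rewrite -big_filter; set t' := [seq _ <- _ | _].
(* As [t'] avoids [s], both fit together into the total sum [S]; since [s] alone takes more than
   [S - e]^ p[, at most]e [^ p] is left for [t']. *)
have : (\sum_(u <- s ++ t') (a u `^ p)%:E <= S)%E.
  apply: sum_le_esum => //; rewrite cat_uniq us filter_uniq//= andbT.
  by apply/hasPn => v; rewrite mem_filter => /andP[].
rewrite big_cat/= => H.
have {}H : (\sum_(u <- t') (a u `^ p)%:E <= (e `^ p)%:E)%E.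
  move: sS H; move: Sfin; case: S {Xa} => // S _.
  rewrite !sumEFin -?EFinB -!EFinD !lte_fin !lee_fin => h1 h2.
  by rewrite -(lerD2l (\sum_(i <- s) a i `^ p)) (le_trans h2)// -lerBlDr ltW.
apply: le_trans H; rewrite !sumEFin lee_fin ler_sum// => u _.
by rewrite ge0_ler_powR ?nnegrE// ltW.
Qed.

Lemma sum_geometric_le (e : R) J : 0 <= e ->
  \sum_(j < J) e * 2^-1 ^+ j <= 2 * e.
Proof.
move=> e0; rewrite -mulr_sumr mulrC ler_wpM2r//.
suff -> : \sum_(j < J) 2^-1 ^+ j = 2 - 2 * 2^-1 ^+ J :> R.
  by rewrite gerBl mulr_ge0// exprn_ge0.
elim: J => [|J IH]; first by rewrite big_ord0 expr0 mulr1 subrr.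
rewrite big_ord_recr/= IH exprS mulrA divff// mul1r.
by rewrite mulr_natl mulr2n opprD addrA subrK.
Qed.

(* Stands in for completeness: the sum of an absolutely convergent series that
   is locally finite ([K v] terms at v) lies in X. *)
Lemma space_series X (a : nat -> V -> R) (K : V -> nat) c (e : R) : 0 < e ->
  (forall j, nneg (a j)) -> (forall j, in_space X (a j)) ->
  (forall j, space_norm X (a j) <= e * 2^-1 ^+ j) ->
  nneg c -> (forall v, c v <= \sum_(j < K v) a j v) ->
  in_space X c /\ space_norm X c <= 2 * e.
Proof.
move=> e0 a0 Xa ae c0 cK.
have cJ v J : (K v <= J)%N -> c v <= \sum_(j < J) a j v.
  move=> KJ; apply: le_trans (cK v) _.
  rewrite -!(big_mkord xpredT (fun j => a j v)) [leRHS](big_cat_nat _ KJ)//=.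
  by rewrite lerDl; apply: sumr_ge0 => j _; exact: a0.
have aJ J : space_norm X (fun v => \sum_(j < J) a j v) <= 2 * e.
  apply: le_trans (space_sum J a0 Xa).2 _.
  by apply: le_trans (sum_geometric_le J (ltW e0)); apply: ler_sum => j _.
have s0 J v : 0 <= \sum_(j < J) a j v by apply: sumr_ge0 => j _; exact: a0.
case: X Xa ae aJ => [p p1|] Xa ae aJ.
  have p0 : 0 < p by rewrite (lt_le_trans ltr01).
  have cs : (\esum_(v in [set: V]) (c v `^ p)%:E <= ((2 * e) `^ p)%:E)%E.
    apply: esum_le_seq => s us _.
    (* On a finite set of vertices one number of terms serves all of them, so a partial sum
       dominates [c] there. *)
    pose J := \max_(v <- s) K v.
    have XJ := (space_sum J a0 Xa).1.
    have aE := pesumE p1 XJ.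
    apply: (@le_trans _ _ (\esum_(v in [set: V]) ((\sum_(j < J) a j v) `^ p)%:E)%E).
      apply: le_trans (sum_le_esum _ us (fun _ _ => I)).
      rewrite !sumEFin lee_fin big_seq [leRHS]big_seq ler_sum// => v vs.
      apply: (ge0_ler_powR (ltW p0)); rewrite ?nnegrE//; apply: cJ.
      by rewrite /J (big_rem _ vs)/= leq_maxl.
    rewrite aE lee_fin.
    apply: (ge0_ler_powR (ltW p0)); rewrite ?nnegrE ?powR_ge0//; last exact: aJ.
    by rewrite mulr_ge0// ltW.
  split; first exact: le_lt_trans cs (ltry _).
  by apply: pnorm_le => //; rewrite mulr_ge0// ltW.
have cle v : c v <= 2 * e.
  apply: le_trans (cK v) _; apply: le_trans (aJ (K v)).
  exact: (coord_le_norm _ (s0 _) (space_sum _ a0 Xa).1).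
split.
  move=> d d0.
  have d20 : 0 < d / 2 by rewrite divr_gt0.
  (* Membership in the [C0] space needs a [J] that does not depend on [v]: the terms from [J] on add
     up to at most [2 * (e * 2^-1 ^+ J)], whence the [d / 4] below. *)
  have [J HJ] : exists J, forall v, \sum_(j < K v) a j v <=
      \sum_(j < J) a j v + d / 2.
    have [J HJ] : exists J, e * 2^-1 ^+ J <= d / 4.
      have h1 : `|2^-1 : R| < 1 by rewrite ger0_norm ?invr_ge0// invf_lt1// ltr1n.
      have de : 0 < d / 4 / e by rewrite !divr_gt0.
      have [J _ /(_ J (leqnn J))] := (cvgrPdist_lt _ _).1 (cvg_expr h1) _ de.
      rewrite sub0r normrN ger0_norm ?exprn_ge0// => HJ.
      by exists J; rewrite mulrC -ler_pdivlMr// ltW.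
    exists J => v; have [KJ|JK] := leqP (K v) J.
      rewrite -!(big_mkord xpredT (fun j => a j v)) [in leRHS](big_cat_nat _ KJ)//=.
      rewrite -addrA lerDl addr_ge0 ?(ltW d20)//.
      by apply: sumr_ge0 => j _; exact: a0.
    rewrite -!(big_mkord xpredT (fun j => a j v)) (big_cat_nat _ (ltnW JK))//=.
    rewrite lerD2l -{1}[J]add0n big_addn big_mkord.
    apply: (@le_trans _ _ (\sum_(i < K v - J) (e * 2^-1 ^+ J) * 2^-1 ^+ i)).
      apply: ler_sum => i _; rewrite -mulrA -exprD addnC.
      apply: le_trans (ae _); exact: coord_le_norm.
    apply: le_trans (sum_geometric_le _ _) _; first by rewrite mulr_ge0 ?ltW.
    by rewrite mulrC -ler_pdivlMr// -mulrA -invfM -natrM.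
  have [F Ffin Fa] := (space_sum J a0 Xa).1 _ d20.
  exists F => // v /Fa H; apply: le_lt_trans (cK v) _.
  by apply: le_lt_trans (HJ v) _; rewrite [ltRHS]splitr ltrD2r.
have [[w _]|V0] := pselect (exists w : V, True); last first.
  rewrite /= (_ : range c = set0) ?sup0 ?mulr_ge0 ?ltW//.
  by rewrite -subset0 => t [w _ _]; case: V0; exists w.
by apply: ge_sup => [|_ [v _ <-]//]; exists (c w), w.
Qed.

(* With y v = 1 / |mu_v|, the quantity compared with [C] is a power of the norm,
   in the dual of X, of the functional f |-> sum_(u in A) f u. *)
Definition large X (y : V -> R) (A : set V) (C : R) : Prop :=
  match X with
  | Lp p _ => if p == 1 then exists2 u, A u & C < y u
              else (C%:E < \esum_(u in A) (y u `^ (p / (p - 1)))%:E)%E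
  | C0 => (C%:E < \esum_(u in A) (y u)%:E)%E
  end.

Lemma large_sub X y A A' C : nneg y -> A `<=` A' ->
  large X y A C -> large X y A' C.
Proof.
move=> y0 AA'; case: X => [p p1|] /=; last first.
  move=> /lt_le_trans; apply; apply: ge_ereal_sup => _ [F [Ff FA] <-].
  by apply: esum_ge; exists F => //; split => // x /FA/AA'.
case: ifP => _; first by move=> [u /AA']; exists u.
move=> /lt_le_trans; apply; apply: ge_ereal_sup => _ [F [Ff FA] <-].
by apply: esum_ge; exists F => //; split => // x /FA/AA'.
Qed.

Lemma large_le X y A C C' : C <= C' -> large X y A C' -> large X y A C.
Proof.
move=> CC'; case: X => [p p1|] /=; last by apply: le_lt_trans; rewrite lee_fin.
case: ifP => _; last by apply: le_lt_trans; rewrite lee_fin.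
by move=> [u Au Cu]; exists u => //; exact: le_lt_trans Cu.
Qed.

(* A crude form of Hoelder's inequality, enough here: when [a] has norm 1, sum
   Young's inequality a y <= a^p + y^q. *)
Lemma dual_bound X y A C a s : nneg a -> nneg y -> in_space X a ->
  0 <= C -> ~ large X y A C -> uniq s -> (forall u, u \in s -> A u) ->
  \sum_(u <- s) a u * y u <= (1 + C) * space_norm X a.
Proof.
move=> + y0 + C0 nl us sA.
have C1 : 0 < 1 + C by rewrite ltr_pwDl.
(* Both sides are homogeneous in [a]; when the norm is 0, the family vanishes and so does the
   sum. *)
wlog : a / space_norm X a = 1.
  move=> H a0 Xa; have N0 := space_norm_ge0 X a0.
  have [N00|N0'] := eqVneq (space_norm X a) 0.
    rewrite N00 mulr0 big1// => u _.
    by rewrite (space_norm_eq0 a0 Xa N00) mul0r.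
  have Np : 0 < space_norm X a by rewrite lt0r N0'.
  set N := space_norm X a in N0 N0' Np *.
  have b0 v : 0 <= N^-1 * a v by rewrite mulr_ge0// invr_ge0.
  have iN0 : 0 <= N^-1 by rewrite invr_ge0.
  have := H (fun v => N^-1 * a v).
  rewrite (space_normZ iN0 a0 (fun=> erefl) Xa) mulVf//.
  move=> /(_ erefl b0 (in_spaceZ iN0 a0 (fun=> erefl) Xa)).
  rewrite mulr1; under eq_bigr do rewrite -mulrA.
  by rewrite -mulr_sumr mulrC ler_pdivrMr.
move=> N1 a0 Xa; rewrite N1 mulr1.
case: X Xa N1 nl => [p p1|] Xa N1 /=; last first.
  move=> /negP; rewrite -leNgt => yC.
  apply: (@le_trans _ _ C); last by rewrite lerDr.
  have := le_trans (sum_le_esum _ us sA) yC.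
  rewrite sumEFin lee_fin; apply: le_trans; apply: ler_sum => u _.
  by rewrite ler_piMl// -N1 coord_le_norm.
have p0 : 0 < p by rewrite (lt_le_trans ltr01).
have ap : \sum_(u <- s) a u `^ p <= 1.
  have := sum_le_esum (fun v => (a v `^ p)%:E) us (fun u _ => I).
  rewrite (pesumE p1 Xa) sumEFin lee_fin; move: N1; rewrite /space_norm => ->.
  by rewrite powR1.
case: ifPn => [/eqP p1E|p1'].
  move=> yC; apply: (@le_trans _ _ (C * \sum_(u <- s) a u `^ p)); last first.
    by apply: (@le_trans _ _ C); [rewrite ler_piMr|rewrite lerDr].
  rewrite mulr_sumr big_seq [leRHS]big_seq ler_sum// => u us'.
  rewrite p1E powRr1// mulrC ler_wpM2r// leNgt; apply/negP => Cy.
  by apply: yC; exists u => //; exact: sA.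
move=> /negP; rewrite -leNgt => yC.
have {}yC := le_trans (sum_le_esum (fun u => (y u `^ (p / (p - 1)))%:E) us sA) yC.
rewrite sumEFin lee_fin in yC.
apply: le_trans (lerD ap yC); rewrite -big_split/=; apply: ler_sum => u _.
have p_gt1 : 1 < p by rewrite lt_neqAle eq_sym p1'.
have pm1 : 0 < p - 1 by rewrite subr_gt0.
have q0 : 0 < p / (p - 1) by rewrite divr_gt0.
have pq : p^-1 + (p / (p - 1))^-1 = 1.
  by rewrite invf_div mulrBl divff ?lt0r_neq0// mul1r addrC subrK.
apply: le_trans (conjugate_powR (a0 u) (y0 u) p0 q0 pq) _.
apply: lerD.
  by rewrite ler_pdivrMr// ler_peMr ?powR_ge0.
rewrite ler_pdivrMr// ler_peMr ?powR_ge0// ler_pdivlMr// mul1r.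
by rewrite gerBl.
Qed.

Lemma large_witness X y C : (forall v, 0 < y v) -> 0 < C ->
  exists C', forall A, large X y A C' ->
  exists (s : seq V) (c : V -> R), [/\ uniq s, forall u, u \in s -> A u,
    (forall u, 0 <= c u), (forall u, u \notin s -> c u = 0) &
    C * space_norm X (fun u => c u / y u) < \sum_(u <- s) c u].
Proof.
move=> y0 C_gt0; case: X => [p p1|]; last first.
  exists C => A /lt_esum_seq[s [us sA]]; rewrite sumEFin lte_fin => Cs.
  exists s, (fun u => if u \in s then y u else 0); split => //.
  - by move=> u; case: ifP => // _; exact: ltW.
  - by move=> u /negbTE ->.
  have -> : \sum_(u <- s) (if u \in s then y u else 0) = \sum_(u <- s) y u.
    by rewrite big_seq [RHS]big_seq; apply: eq_bigr => u ->.
  (* The entries [c u / y u] are 0 or 1, so the norm is at most 1. *)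
  apply: le_lt_trans Cs; rewrite ger_pMr//.
  have [[w _]|V0] := pselect (exists w : V, True); last first.
    rewrite /=; set c := (fun u : V => _); rewrite (_ : range c = set0) ?sup0//.
    by rewrite -subset0 => t [w _ _]; case: V0; exists w.
  apply: ge_sup; first by eexists; exists w.
  move=> _ [v _ <-]; case: ifP => _; last by rewrite mul0r.
  by rewrite divff// lt0r_neq0.
have p0 : 0 < p by rewrite (lt_le_trans ltr01).
have [p1E|p1'] := eqVneq p 1.
  exists C => A; rewrite /large; case: eqP => // _ [u Au Cy].
  exists [:: u], (fun v => (v == u)%:R); split => //.
  - by move=> v; rewrite inE => /eqP ->.
  - by move=> v; rewrite inE => /negbTE ->.
  rewrite big_seq1 eqxx -ltr_pdivlMl// mulr1.
  apply: (@le_lt_trans _ _ (y u)^-1); last first.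
    by rewrite ltf_pV2// posrE.
  apply: pnorm_le => //; first by rewrite invr_ge0 ltW.
  rewrite (_ : \esum_(v in _) _ =
      \esum_(v in [set u]) (((v == u)%:R / y v) `^ p)%:E)%E; last first.
    rewrite [RHS]esum_mkcond; apply: eq_esum => v _; rewrite in_set1.
    by case: eqP => // _; rewrite mul0r powR0// gt_eqF.
  by rewrite esum_set1 ?lee_fin ?powR_ge0// eqxx mul1r.
have p_gt1 : 1 < p by rewrite lt_neqAle eq_sym p1'.
have pm1 : 0 < p - 1 by rewrite subr_gt0.
have [q qE] : exists q, q = p / (p - 1) by exists (p / (p - 1)).
have q0 : 0 < q by rewrite qE divr_gt0.
exists (C `^ q) => A; rewrite /large (negbTE p1') -qE.
move=> /lt_esum_seq[s [us sA]]; rewrite sumEFin lte_fin => Cs.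
exists s, (fun u => if u \in s then y u `^ q else 0); split => //.
- by move=> u; case: ifP => // _; exact: powR_ge0.
- by move=> u /negbTE ->.
have -> : \sum_(u <- s) (if u \in s then y u `^ q else 0) = \sum_(u <- s) y u `^ q.
  by rewrite big_seq [RHS]big_seq; apply: eq_bigr => u ->.
set S := \sum_(u <- s) _ in Cs *.
have S0 : 0 < S by apply: le_lt_trans Cs; exact: powR_ge0.
have CS : C < S `^ q^-1.
  have -> : C = (C `^ q) `^ q^-1.
    by rewrite -powRrM mulfV ?lt0r_neq0// powRr1// ltW.
  by rewrite gt0_ltr_powR ?invr_gt0// nnegrE ?powR_ge0// ltW.
have nS : space_norm (Lp p1) (fun u => (if u \in s then y u `^ q else 0) / y u)
    <= S `^ p^-1.
  apply: pnorm_le; rewrite ?powR_ge0//.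
  rewrite -powRrM mulVf ?lt0r_neq0// powRr1 ?(ltW S0)//.
  rewrite (_ : \esum_(v in _) _ = \esum_(v in [set` s]) (y v `^ q)%:E)%E.
    rewrite esum_fset// -?(fsbig_seq _ _ us) ?sumEFin// => v _.
    by rewrite lee_fin powR_ge0.
  rewrite [RHS]esum_mkcond; apply: eq_esum => v _; rewrite mem_setE.
  case: ifP => vs; last by rewrite mul0r powR0// gt_eqF.
  congr EFin; rewrite -[X in _ / X]powRr1 ?ltW// -powRB; last first.
    by rewrite (lt0r_neq0 (y0 v)) implybT.
  rewrite -powRrM; congr (_ `^ _).
  by rewrite qE; field; rewrite lt0r_neq0.
apply: le_lt_trans (ler_wpM2l (ltW C_gt0) nS) _.
have {2}-> : S = S `^ q^-1 * S `^ p^-1.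
  rewrite -powRD; last by rewrite (lt0r_neq0 S0) implybT.
  by rewrite qE invf_div mulrBl divff ?lt0r_neq0// mul1r subrK powRr1// ltW.
by rewrite ltr_pM2r// powR_gt0.
Qed.

End families.

(** * Directed trees and weights *)

Section tree.
Context (V : countType) (E : rel V).

Lemma ChinD m n (u v w : V) :
  Chin E m v u -> Chin E n u w -> Chin E (m + n) v w.
Proof.
elim: m v => [v ->//|m IH v [x vx xu] uw].
by exists x => //; exact: IH.
Qed.

Lemma ChinSr n v w : Chin E n.+1 v w -> exists2 x, Chin E n v x & E x w.
Proof.
elim: n v => [v [x vx ->]|n IH v [x vx /IH[y xy yw]]]; first by exists v.
by exists y => //; exists x.
Qed.

(** Parents being unique, the last edges of two descents to [u] agree and can be removed together;
    neither descent can end before the other, as the root has no parent. Hence the generations below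
    the root are pairwise disjoint. *)
Lemma Chin_unique (hE : directed_tree E) (r : V) (hr : is_root E r) m n u :
  Chin E m r u -> Chin E n r u -> m = n.
Proof.
have root k : Chin E k.+1 r r -> False.
  by move=> /ChinSr[x _]; exact/negP/hr.
elim: m n u => [|m IH] [|n] u //.
- by move=> -> /root.
- by move=> /[swap] -> /root.
move=> /ChinSr[x rx xu] /ChinSr[y ry yu].
by rewrite (IH n x rx)//; rewrite (parent_unique hE xu yu).
Qed.

(** Induction along an undirected path from [r], with the invariant that the current vertex [x]
    descends from [r]. *)
Lemma root_reaches (hE : directed_tree E) (r : V) (hr : is_root E r) v :
  exists n, Chin E n r v.
Proof.
have [->|rv] := eqVneq v r; first by exists 0.
have [|s [+ <-]] := tree_connected hE (u := r) (v := v); first by rewrite eq_sym.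
have : exists n, Chin E n r r by exists 0.
move: {-1 4}r => x; elim: s x => [|y s IH] x [n rx] /=; first by exists n.
move=> /andP[xy]; apply: IH; case/orP: xy => xy.
  by exists n.+1; rewrite -addn1; apply: ChinD rx _; exists y.
(* The path now goes up from [x] to its parent: impossible at the root, and otherwise the parent is
   the penultimate vertex of the descent to [x]. *)
case: n rx => [/= xr|n rx]; first by have := hr y; rewrite -xr xy.
by have [z rz zx] := ChinSr rx; exists n; rewrite (parent_unique hE xy zx).
Qed.

End tree.

Section weights.
Context (R : realType) (k : scalar_field) (V : countType).
Variables (mu : weight R k V).

Definition dual_weight (v : V) : R := (modulus (mu v))^-1.

Lemma modulus_weight_gt0 v : 0 < modulus (mu v).
Proof.
rewrite lt0r modulus_ge0 andbT; apply/eqP => /modulus_eq0/eqP.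
by rewrite (negbTE (weight_neq0 mu v)).
Qed.

Lemma dual_weight_gt0 v : 0 < dual_weight v.
Proof. by rewrite invr_gt0 modulus_weight_gt0. Qed.

(** Gives the three cases one form. For [p = 1] the infimum is below [C^-1] exactly when some
    [dual_weight] exceeds [C]; both fail on an empty generation, where the infimum is [+oo]. *)
Lemma weight_conditionP (X : seq_space R) (A : nat -> set V) :
  weight_condition mu X A <->
  forall C, 0 < C -> \forall j \near \oo, large X dual_weight (A j) C.
Proof.
have to_pinfty (u : nat -> \bar R) : u @ \oo --> +oo%E <->
    forall C, 0 < C -> \forall j \near \oo, (C%:E < u j)%E.
  rewrite cvgeyPgt; split => H C; first by move=> _; exact: H.
  have C0 : 0 < Num.max C 1 by rewrite lt_max ltr01 orbT.
  apply: filterS (H _ C0) => j; apply: le_lt_trans.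
  by rewrite lee_fin le_max lexx.
case: X => [p p1|] /=; last exact: to_pinfty.
case: ifP => _; last first.
  have -> : (fun j => \esum_(u in A j) ((modulus (mu u) `^ (p / (p - 1)))^-1)%:E)
    = (fun j => \esum_(u in A j) (dual_weight u `^ (p / (p - 1)))%:E).
    apply/funext => j; apply: eq_esum => u _; congr EFin.
    by rewrite /dual_weight -(powR_inv1 (modulus_ge0 _)) -powRrM mulN1r powRN.
  exact: to_pinfty.
have inf_ge0 j : (0 <= ereal_inf [set (modulus (mu u))%:E | u in A j])%E.
  by apply: le_ereal_inf_tmp => _ [u _ <-]; rewrite lee_fin modulus_ge0.
have lt_infP C j : 0 < C -> (exists2 u, A j u & C < dual_weight u) <->
    (ereal_inf [set (modulus (mu u))%:E | u in A j] < C^-1%:E)%E.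
  move=> C0; split => [[u Au Cu]|/ereal_inf_lt[_ [u Au <-]]].
    apply: le_lt_trans (ereal_inf_lbound _) _; first by exists u.
    by rewrite lte_fin -[ltLHS]invrK ltf_pV2// posrE dual_weight_gt0.
  rewrite lte_fin => uC; exists u => //.
  rewrite /dual_weight -[ltLHS]invrK ltf_pV2// posrE ?invr_gt0//.
  exact: modulus_weight_gt0.
split => [H C C0|H].
  near=> j; apply/lt_infP => //; near: j.
  by apply: (H (fun x => x < C^-1%:E)%E); apply: lt_nbhsl; rewrite invr_gt0.
move=> U [e /= e0 eU].
apply: filterS (H e^-1 _); last by rewrite invr_gt0.
move=> j /lt_infP /=; rewrite invrK invr_gt0 => /(_ e0).
move: (inf_ge0 j); case: (ereal_inf _) => // x; rewrite lee_fin lte_fin => x0 xe.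
by apply: eU; rewrite /= sub0r normrN ger0_norm.
Unshelve. all: by end_near. Qed.

End weights.

(** * Increasing sequences of integers *)

Lemma increasing_seq_ge_id (n : nat -> nat) j : increasing_seq n -> (j <= n j)%N.
Proof.
move=> /increasing_seqP n_incr; elim: j => // j IH.
exact: leq_ltn_trans IH (n_incr j).
Qed.

(** Dependent choice: in [Q i m n] the argument [m] is the term chosen just before [n]. The first
    term has no predecessor and is chosen above 0. *)
Lemma increasing_extraction (Q : nat -> nat -> nat -> Prop) :
  (forall i m, exists2 n, (m < n)%N & Q i m n) ->
  exists n : nat -> nat, [/\ increasing_seq n, forall j, (0 < n j)%N,
    (exists m, Q 0%N m (n 0%N)) & forall i, Q i.+1 (n i) (n i.+1)].
Proof.
move=> H; have {}H im : {n | (im.2 < n)%N & Q im.1 im.2 n}.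
  by apply: cid2; exact: H.
pose next i m := s2val (H (i, m)).
pose n := fix n i := if i is j.+1 then next i (n j) else next 0%N 0%N.
have n0 i m : (m < next i m)%N by exact: (s2valP (H (i, m))).
exists n; split.
- apply/increasing_seqP => i; exact: n0.
- by case=> [|j] /=; [exact: n0|apply: leq_ltn_trans (n0 _ _)].
- by exists 0%N; exact: (s2valP' (H (0%N, 0%N))).
- by move=> i; exact: (s2valP' (H (i.+1, n i))).
Qed.

(** * The backward shift *)

(* [all_algebra] exports another constant [scalar]. *)
Local Notation scalar := Defs.scalar.

Section has_sum.
Context (K : numFieldType) (V : choiceType).

(** If [s] and [t] differed, a finite set adapted to the error [|t - s|], enlarged by [F], would
    give a contradiction. *)
Lemma has_sum_eventually (A : set V) (f : V -> K) (s t : K) (F : set V) :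
  has_sum A f s -> fsets A F ->
  (forall G, fsets A G -> F `<=` G -> \sum_(u \in G) f u = t) -> s = t.
Proof.
move=> fs [Ffin FA] Ht; apply/eqP/negPn/negP => st.
have e0 : 0 < `|t - s| by rewrite normr_gt0 subr_eq0 eq_sym.
have [G [Gfin GA]] := fs _ e0.
have GF : fsets A (G `|` F).
  by split; [rewrite finite_setU|move=> x [/GA|/FA]].
move=> /(_ _ GF (@subsetUl _ _ _)).
by rewrite (Ht _ GF (@subsetUr _ _ _)) ltxx.
Qed.

Lemma has_sum0 (A : set V) (f : V -> K) (s : K) :
  has_sum A f s -> (forall u, A u -> f u = 0) -> s = 0.
Proof.
move=> fs f0; apply: (has_sum_eventually fs (F := set0)) => [|G [_ GA] _].
  by split; [exact: finite_set0|exact: sub0set].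
by apply: fsbig1 => u /GA/f0.
Qed.

End has_sum.

Section modulus_theory.
Context (R : realType) (k : scalar_field).

Lemma modulus1 : modulus (1 : scalar R k) = 1.
Proof.
have : modulus (1 : scalar R k) * modulus (1 : scalar R k) =
    modulus (1 : scalar R k) by rewrite -modulusM mulr1.
move=> /eqP; rewrite -[X in _ == X]mulr1 => /eqP /mulfI -> //.
by apply/eqP => /modulus_eq0/eqP; rewrite oner_eq0.
Qed.

Lemma modulusN (x : scalar R k) : modulus (- x) = modulus x.
Proof. by apply: (@of_real_inj R k); rewrite !of_real_modulus normrN. Qed.

Lemma modulus_of_real (a : R) : modulus (of_real k a) = `|a|.
Proof.
rewrite /modulus /of_real /scalar; case: k => //.
by rewrite normc_def/= expr0n/= addr0 sqrtr_sqr.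
Qed.

Lemma modulus_sum (I : Type) (s : seq I) (P : pred I) (f : I -> scalar R k) :
  modulus (\sum_(i <- s | P i) f i) <= \sum_(i <- s | P i) modulus (f i).
Proof.
elim/big_rec2: _ => [|i y1 y2 _ H]; first by rewrite modulus0.
by apply: le_trans (modulusD _ _) _; rewrite lerD2l.
Qed.

Lemma of_real_gt0 (a : R) : 0 < a -> 0 < of_real k a.
Proof.
move=> a0; rewrite lt0r -(of_real0 R k) of_real_le ltW// andbT.
by apply/eqP => /of_real_inj a00; rewrite a00 ltxx in a0.
Qed.

Lemma of_real_sum (I : Type) (s : seq I) (f : I -> R) :
  of_real k (\sum_(i <- s) f i) = \sum_(i <- s) of_real k (f i).
Proof. by apply: (big_morph _ (of_realD k) (of_real0 R k)). Qed.

End modulus_theory.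

Section wspace_theory.
Context (R : realType) (k : scalar_field) (V : countType).
Variables (mu : weight R k V) (X : seq_space R).
Local Notation K := (scalar R k).
Local Notation W := (wspace mu X).
Implicit Types (f g h : W).
Local Notation y := (dual_weight mu).

Definition real_norm f : R := space_norm X (weighted mu f).

Lemma normE f : `|f| = of_real k (real_norm f).
Proof. by []. Qed.

Lemma real_norm_ge0 f : 0 <= real_norm f.
Proof. by apply: space_norm_ge0; exact: weighted_ge0. Qed.

Lemma real_normZ (c : K) f : real_norm (c *: f) = modulus c * real_norm f.
Proof.
by apply: (@of_real_inj _ k); rewrite of_realM -!normE normrZ of_real_modulus.
Qed.

Lemma wspaceD f g v : (f + g) v = f v + g v.
Proof. by []. Qed.

Lemma wspaceB f g v : (f - g) v = f v - g v.
Proof. by []. Qed.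

Lemma wspaceZ (c : K) f v : (c *: f) v = c * f v.
Proof. by []. Qed.

Lemma wspace_sum (I : Type) (s : seq I) (F : I -> W) v :
  (\sum_(i <- s) F i) v = \sum_(i <- s) F i v.
Proof. by apply: (big_morph (fun f : W => f v)). Qed.

Lemma wspace_eqP f g : (forall v, f v = g v) -> f = g.
Proof. by move=> fg; apply/val_inj/funext. Qed.

Lemma weightedE (f : V -> K) v : weighted mu f v * y v = modulus (f v).
Proof.
by rewrite /weighted modulusM /dual_weight mulfK// gt_eqF ?modulus_weight_gt0.
Qed.

Lemma modulus_coord f v : modulus (f v) <= real_norm f * y v.
Proof.
rewrite -weightedE ler_wpM2r ?(ltW (dual_weight_gt0 _ _))//.
exact: (coord_le_norm v (weighted_ge0 mu f) (wspaceP f)).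
Qed.

Lemma basisE u v : basis_vec mu X u v = (v == u)%:R.
Proof. by []. Qed.

Lemma fin_vecE (s : seq V) (c : V -> K) v : uniq s ->
  (\sum_(u <- s) c u *: basis_vec mu X u) v = if v \in s then c v else 0.
Proof.
move=> us; rewrite wspace_sum.
have H u : (c u *: basis_vec mu X u) v = if u == v then c v else 0.
  rewrite wspaceZ basisE eq_sym.
  by case: eqP => [->|]; rewrite ?mulr1 ?mulr0.
under eq_bigr do rewrite H.
case: ifP => vs.
  by rewrite (bigD1_seq v)//= eqxx big1 ?addr0// => u /negbTE ->.
rewrite big_seq big1// => u us'; case: eqP => // uv.
by rewrite uv vs in us'.
Qed.

End wspace_theory.

Section shift.
Context (R : realType) (k : scalar_field) (V : countType) (E : rel V).
Hypothesis hE : directed_tree E.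
Variables (mu : weight R k V) (X : seq_space R).
Variable B : {linear wspace mu X -> wspace mu X}.
Hypothesis hB : is_backward_shift E B.
Local Notation W := (wspace mu X).
Local Notation K := (scalar R k).
Local Notation y := (dual_weight mu).
Local Notation e_ := (basis_vec mu X).
Implicit Types (f g h : W).

Lemma shift_basis u v : B (e_ u) v = (E v u)%:R.
Proof.
have [vu|vu] := boolP (E v u).
  apply: (has_sum_eventually (hB (e_ u) v) (F := [set u])) => [|G [Gfin _] uG].
    by split; [exact: finite_set1|move=> _ ->].
  rewrite (fsbigD1 u)//=; last exact: uG.
  rewrite fsbig1 ?addr0; first by rewrite eqxx.
  by move=> w [_ /eqP/negbTE wu]; rewrite wu.
apply: (has_sum0 (hB (e_ u) v)) => w vw /=; case: eqP => // wu.
by move: vu; rewrite -wu vw.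
Qed.

Lemma shift_basis_child u v : E v u -> B (e_ u) = e_ v.
Proof.
move=> vu; apply: wspace_eqP => w; rewrite shift_basis basisE; congr _%:R.
have [wu|wu] := boolP (E w u); first by rewrite (parent_unique hE wu vu) eqxx.
by case: eqP => // wv; move: wu; rewrite wv vu.
Qed.

Lemma shift_basis_root r : is_root E r -> B (e_ r) = 0.
Proof.
by move=> hr; apply: wspace_eqP => w; rewrite shift_basis (negbTE (hr w)).
Qed.

Lemma iter_shift_basis n u v : Chin E n v u -> iter n B (e_ u) = e_ v.
Proof.
elim: n v => [v -> //|n IH v [w vw wu]].
by rewrite iterS (IH w wu); exact: shift_basis_child.
Qed.

(** With linearity, this shows that the value of [iter n B f] at [v] depends only on [f] over
    [Chin E n v]. *)
Lemma iter_shift_eq0 n f v :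
  (forall u, Chin E n v u -> f u = 0) -> iter n B f v = 0.
Proof.
elim: n v => [v f0|n IH v f0]; first exact: f0.
rewrite iterS; apply: (has_sum0 (hB (iter n B f) v)) => w vw.
by apply: IH => u wu; apply: f0; exists w.
Qed.

Lemma iter_shiftP n (a : K) f g :
  iter n B (a *: f + g) = a *: iter n B f + iter n B g.
Proof. by elim: n => // n IH; rewrite !iterS IH linearP. Qed.

Lemma iter_shift0 n : iter n B 0 = 0.
Proof. by elim: n => // n IH; rewrite iterS IH linear0. Qed.

Lemma iter_shiftD n f g : iter n B (f + g) = iter n B f + iter n B g.
Proof. by have := iter_shiftP n 1 f g; rewrite !scale1r. Qed.

Lemma iter_shiftZ n (a : K) f : iter n B (a *: f) = a *: iter n B f.
Proof. by have := iter_shiftP n a f 0; rewrite iter_shift0 !addr0. Qed.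

Lemma iter_shift_sum n (I : Type) (s : seq I) (F : I -> W) :
  iter n B (\sum_(i <- s) F i) = \sum_(i <- s) iter n B (F i).
Proof. exact: (big_morph _ (iter_shiftD n) (iter_shift0 n)). Qed.

(** Linearity settles finite combinations; general vectors are reached by truncation, so that
    iterated infinite sums never have to be rearranged. *)
Lemma iter_fin_vec n (s : seq V) (c : V -> K) v :
  iter n B (\sum_(u <- s) c u *: e_ u) v =
  \sum_(u <- s | `[< Chin E n v u >]) c u.
Proof.
rewrite iter_shift_sum wspace_sum [RHS]big_mkcond; apply: eq_bigr => u _.
rewrite iter_shiftZ wspaceZ; case: asboolP => vu.
  by rewrite (iter_shift_basis vu) basisE eqxx mulr1.
rewrite iter_shift_eq0 ?mulr0// => w vw; rewrite basisE.
by case: eqP => // wu; case: vu; rewrite -wu.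
Qed.

Hypothesis hBb : bounded_operator B.

Lemma real_bound : exists2 M : R, 1 <= M &
  forall f, real_norm (B f) <= M * real_norm f.
Proof.
have [M HM] := hBb; exists (modulus M + 1); first by rewrite lerDr modulus_ge0.
move=> f; rewrite -(of_real_le k) of_realM -!normE.
(* [M] is a scalar of the field, possibly complex; but [M * |f|] bounds a norm, so it is nonnegative
   and equals its own absolute value. *)
have H := le_trans (normr_ge0 _) (HM f).
apply: le_trans (HM f) _; rewrite -(ger0_norm H) normrM normr_id.
apply: ler_wpM2r => //.
by rewrite -of_real_modulus of_real_le lerDl.
Qed.

End shift.

(** * Norms of the functionals that evaluate an iterate at a vertex *)

Section orbits.
Context (R : realType) (k : scalar_field) (V : countType) (E : rel V).
Hypothesis hE : directed_tree E.
Variables (mu : weight R k V) (X : seq_space R).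
Variable B : {linear wspace mu X -> wspace mu X}.
Hypothesis hB : is_backward_shift E B.
Variable M : R.
Hypothesis M1 : 1 <= M.
Hypothesis hM : forall f, real_norm (B f) <= M * real_norm f.
Local Notation W := (wspace mu X).
Local Notation K := (scalar R k).
Local Notation y := (dual_weight mu).
Local Notation e_ := (basis_vec mu X).
Implicit Types (f g h : W).

Let M_gt0 : 0 < M. Proof. exact: lt_le_trans ltr01 M1. Qed.

Lemma iter_norm_le n f : real_norm (iter n B f) <= M ^+ n * real_norm f.
Proof.
elim: n => [|n IH]; first by rewrite expr0 mul1r.
rewrite iterS exprS -mulrA; apply: le_trans (hM _) _.
by rewrite ler_pM2l.
Qed.

(** [f] is split into a finite truncation [h], to which [dual_bound] applies, and a remainder whose
    contribution is at most an arbitrary [e]. *)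
Lemma orbit_coord_bound n v (C : R) f : 0 <= C -> ~ large X y (Chin E n v) C ->
  modulus (iter n B f v) <= (1 + C) * real_norm f.
Proof.
move=> C0 nl; apply/ler_addgt0Pr => e e0.
have y0 := dual_weight_gt0 mu v.
have Mn0 : 0 < M ^+ n by rewrite exprn_gt0.
(* The remainder gains at most a factor [M ^+ n] from the iterate and a factor [y v] from the
   evaluation at [v]. *)
have d0 : 0 < e / (M ^+ n * y v) by rewrite divr_gt0// mulr_gt0.
have [F Ffin HF] := space_tail (weighted_ge0 mu f) (wspaceP f) d0.
pose s := finmap.enum_fset (fset_set F).
have us : uniq s by exact: finmap.fset_uniq.
have sF u : (u \in s) = `[< F u >].
  by rewrite /s in_fset_set// -asboolb; apply/asboolP/asboolP; rewrite inE.
pose h : W := \sum_(u <- s) f u *: e_ u.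
have hfE u : h u = if u \in s then f u else 0 by exact: fin_vecE.
have fE : f = h + (f - h) by rewrite addrC subrK.
rewrite {1}fE iter_shiftD wspaceD; apply: le_trans (modulusD _ _) _.
apply: lerD.
  rewrite (iter_fin_vec hE hB); apply: le_trans (modulus_sum _ _ _) _.
  rewrite -big_filter.
  under eq_bigr do rewrite -(weightedE mu).
  apply: (dual_bound (weighted_ge0 mu f) _ (wspaceP f) C0 nl).
  - by move=> u; rewrite ltW// dual_weight_gt0.
  - exact: filter_uniq.
  - by move=> u; rewrite mem_filter => /andP[/asboolP].
apply: le_trans (modulus_coord _ _) _.
rewrite -ler_pdivlMr//; apply: le_trans (iter_norm_le _ _) _.
rewrite mulrC -ler_pdivlMr// -mulrA -invfM [y v * _]mulrC.
apply: HF => [u|u|u Fu]; first exact: weighted_ge0.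
  rewrite /weighted wspaceB hfE; case: ifP => _; last by rewrite subr0.
  by rewrite subrr mul0r modulus0 modulus_ge0.
by rewrite /weighted wspaceB hfE sF asboolT// subrr mul0r modulus0.
Qed.

(** For [C >= 0], the functional sending [f] to the value of [iter n B f] at [v] has norm greater
    than [C]. Unlike [large], this form allows [n] and [n + l] to be compared. *)
Definition coord_norm_gt n v (C : R) : Prop :=
  exists f : W, C * real_norm f < modulus (iter n B f v).

Lemma coord_norm_gt_large n v C : 0 <= C ->
  coord_norm_gt n v (1 + C) -> large X y (Chin E n v) C.
Proof.
move=> C0 [f]; rewrite ltNge => H; apply: contrapT => nl.
by move: H; rewrite orbit_coord_bound.
Qed.

(** Every basis vector of generation [n] below [v] is sent to [e_ v], so the vector from
    [large_witness] is sent to [S] times [e_ v]; dividing by [S] gives [h]. *)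
Lemma large_preimage C : 0 < C -> exists C', forall n v,
  large X y (Chin E n v) C' -> exists h : W, [/\ iter n B h = e_ v,
    forall u, ~ Chin E n v u -> h u = 0 & C * real_norm h < 1].
Proof.
move=> C0; have [C' HC'] := large_witness X (dual_weight_gt0 mu) C0.
exists C' => n v /HC'[s [c [us sA c0 cs]]].
set N := space_norm _ _ => CN.
set S := \sum_(u <- s) c u in CN.
have S0 : 0 < S.
  apply: le_lt_trans CN; rewrite mulr_ge0 ?(ltW C0)//.
  by apply: space_norm_ge0 => u; rewrite divr_ge0// ltW// dual_weight_gt0.
pose h : W := \sum_(u <- s) of_real k (c u) *: e_ u.
have hE' u : h u = of_real k (c u).
  by rewrite fin_vecE//; case: ifPn => // /cs ->; rewrite of_real0.
have hN : real_norm h = N.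
  rewrite /real_norm; congr space_norm; apply/funext => u.
  by rewrite /weighted hE' modulusM modulus_of_real ger0_norm// /dual_weight invrK.
have hS : iter n B h = of_real k S *: e_ v.
  rewrite iter_shift_sum of_real_sum scaler_suml big_seq [RHS]big_seq.
  apply: eq_bigr => u us'; rewrite iter_shiftZ.
  by rewrite (iter_shift_basis hE hB (sA u us')).
exists (of_real k S^-1 *: h); split.
- rewrite iter_shiftZ hS scalerA -of_realM mulVf ?lt0r_neq0//.
  have -> : of_real k 1 = 1.
    by rewrite /of_real; case: k.
  by rewrite scale1r.
- move=> u nu; rewrite wspaceZ hE' cs ?of_real0 ?mulr0//.
  by apply/negP => /sA.
- rewrite real_normZ modulus_of_real ger0_norm ?invr_ge0 ?ltW// hN.
  by rewrite mulrCA mulrC ltr_pdivrMr// mul1r.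
Qed.

Lemma large_coord_norm_gt C : 0 < C -> exists C', forall n v,
  large X y (Chin E n v) C' -> coord_norm_gt n v C.
Proof.
move=> /large_preimage[C' HC']; exists C' => n v /HC'[h [hv _ hC]].
by exists h; rewrite hv basisE eqxx modulus1.
Qed.

(** [iter l B f] is a witness for [n], with norm at most [M ^+ l] times that of [f]. *)
Lemma coord_norm_gtD n l v C : 0 <= C ->
  coord_norm_gt (n + l) v (C * M ^+ l) -> coord_norm_gt n v C.
Proof.
move=> C0 [f]; rewrite iterD => H; exists (iter l B f).
apply: le_lt_trans H; rewrite -mulrA ler_wpM2l//; exact: iter_norm_le.
Qed.

Lemma coord_norm_gt_le n v C C' : C <= C' ->
  coord_norm_gt n v C' -> coord_norm_gt n v C.
Proof.
move=> CC' [f H]; exists f; apply: le_lt_trans H.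
by rewrite ler_wpM2r// real_norm_ge0.
Qed.

End orbits.

(** * Weak limit points *)

Section weak_topology.
Context (K : numFieldType) (W : normedModType K).

Lemma dual_cvg_weak (phi : topological_dual W) (x : weak_space W) :
  (fun z : weak_space W => sval phi z : K^o) @ x --> (sval phi x : K^o).
Proof.
have h1 : {for x, continuous (fun z : weak_space W =>
    (fun psi => sval psi z) : {ptws (topological_dual W) -> K})}.
  exact: initial_continuous.
have h2 := @proj_continuous _ (fun _ : topological_dual W => K) phi.
exact: (cvg_comp _ _ h1 (h2 _)).
Qed.

(** The topology of pointwise convergence is a supremum, so continuity of the identity is tested on
    one functional [phi] at a time. *)
Lemma nbhs_weak (x : W) (U : set W) :
  nbhs (x : weak_space W) U -> nbhs x U.
Proof.
suff : continuous (id : W -> weak_space W) by move=> /(_ x U).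
apply: continuous_comp_initial => z.
apply/cvg_sup => phi S [P [[Q oQ <-]]] /= Qz /filterS; apply.
by apply: (svalP phi z); exact: open_nbhs_nbhs.
Qed.

Lemma limit_point_weak (A : set W) (x : W) :
  limit_point A x -> weak_limit_point A x.
Proof. by move=> Ax U /nbhs_weak/Ax. Qed.

End weak_topology.

Section evaluation.
Context (R : realType) (k : scalar_field) (V : countType).
Variables (mu : weight R k V) (X : seq_space R).
Local Notation W := (wspace mu X).
Local Notation K := (scalar R k).

Definition coord (v : V) (f : W) : K^o := f v.

Fact coord_linear v : linear (coord v). Proof. by []. Qed.

HB.instance Definition _ v :=
  GRing.isLinear.Build K W K^o _ (coord v) (coord_linear v).

Lemma coord_continuous v : continuous (coord v).
Proof.
apply: bounded_linear_continuous; apply/linear_boundedP.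
exists (of_real k (dual_weight mu v)); split.
  by rewrite realE -(of_real0 R k) of_real_le ltW// dual_weight_gt0.
move=> M yM f; apply: le_trans (ler_wpM2r (normr_ge0 _) (ltW yM)).
by rewrite normE -of_realM mulrC -of_real_modulus of_real_le modulus_coord.
Qed.

(** Weak topology enters the argument through these neighbourhoods alone: evaluation at a vertex is
    a continuous functional. *)
Lemma nbhs_weak_coord (x : W) (v : V) (e : R) : 0 < e ->
  nbhs (x : weak_space W) [set z : W | modulus (z v - x v) < e].
Proof.
move=> e0.
have := @dual_cvg_weak K W
  (exist _ (coord v : {linear W -> K^o}) (@coord_continuous v)) x.
move=> /cvgrPdist_lt /(_ _ (of_real_gt0 k e0)); apply: filterS => z /=.
rewrite distrC lt_neqAle -of_real_modulus of_real_le.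
by rewrite (inj_eq (@of_real_inj _ k)) -lt_neqAle.
Qed.

End evaluation.

(** * Orbits and the weight condition *)

Section main_implications.
Context (R : realType) (k : scalar_field) (V : countType) (E : rel V).
Hypothesis hE : directed_tree E.
Variable r : V.
Hypothesis hr : is_root E r.
Variables (mu : weight R k V) (X : seq_space R).
Variable B : {linear wspace mu X -> wspace mu X}.
Hypothesis hB : is_backward_shift E B.
Variable M : R.
Hypothesis M1 : 1 <= M.
Hypothesis hM : forall f, real_norm (B f) <= M * real_norm f.
Local Notation W := (wspace mu X).
Local Notation K := (scalar R k).
Local Notation y := (dual_weight mu).
Local Notation e_ := (basis_vec mu X).
Implicit Types (f g h : W).

Let M_gt0 : 0 < M. Proof. exact: lt_le_trans ltr01 M1. Qed.

Let y_ge0 v : 0 <= y v. Proof. exact: ltW (dual_weight_gt0 _ _). Qed.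

(** An accumulation point of the orbit as a set is approached at arbitrarily late times: by
    induction on [N], iterate [N] is excluded by shrinking [U] through a coordinate where it differs
    from [x]. *)
Lemma weak_limit_point_frequently f (x : W) (U : set W) N :
  weak_limit_point (op_orbit B f) x -> nbhs (x : weak_space W) U ->
  exists2 n, (N <= n)%N & U (iter n B f).
Proof.
move=> fx xU.
(* The extra clause [iter n B f <> x] makes the induction work when iterate [N] equals [x] and no
   neighbourhood can exclude it. *)
suff [n [Nn _ Un]] : exists n, [/\ (N <= n)%N, iter n B f <> x & U (iter n B f)].
  by exists n.
elim: N U xU => [|N IH] U xU.
  have [z [/eqP zx [n _ nz] Uz]] := fx U xU.
  by exists n; rewrite nz.
have [Nx|Nx] := pselect (iter N B f = x).
  have [n [Nn nx Un]] := IH U xU; exists n; split => //.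
  by rewrite ltn_neqAle Nn andbT; apply/eqP => Nn'; apply: nx; rewrite -Nn'.
have [v Nv] : exists v, iter N B f v <> x v.
  apply: contrapT => /forallNP H; apply: Nx.
  by apply: wspace_eqP => v; exact: contrapT.
have d0 : 0 < modulus (iter N B f v - x v).
  rewrite lt0r modulus_ge0 andbT; apply/eqP => /modulus_eq0/eqP.
  by rewrite subr_eq0 => /eqP.
have [n [Nn nx [Un dn]]] := IH _ (filterI xU (nbhs_weak_coord x v d0)).
exists n; split => //; rewrite ltn_neqAle Nn andbT.
by apply/eqP => Nn'; rewrite /= Nn' ltxx in dn.
Qed.

Lemma weak_limit_point_weight_condition f (x : W) : x != 0 ->
  weak_limit_point (op_orbit B f) x ->
  exists (n : nat -> nat) (v : V), [/\ increasing_seq n,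
    forall j, (0 < n j)%N & weight_condition mu X (fun j => Chin E (n j) v)].
Proof.
move=> x0 fx.
have [v xv] : exists v, x v <> 0.
  apply: contrapT => /forallNP H; move/eqP: x0; apply.
  by apply: wspace_eqP => v; exact: contrapT.
have xv0 : 0 < modulus (x v).
  by rewrite lt0r modulus_ge0 andbT; apply/eqP => /modulus_eq0.
set c := modulus (x v) / 2.
have c0 : 0 < c by rewrite divr_gt0.
have [depth Hdepth] := choice (root_reaches hE hr).
have [|n [n_incr n_gt0 _ nl]] := @increasing_extraction
    (fun i _ n => large X y (Chin E n v) i%:R).
  move=> i m.
  have i0 : 0 < 1 + i%:R :> R by rewrite ltr_pwDl.
  have [F Ffin HF] := space_tail (weighted_ge0 mu f) (wspaceP f) (divr_gt0 c0 i0).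
  (* Depths add up along descents, so for [n > N] no vertex of [F] lies in [Chin E n v]. *)
  pose N := \max_(u <- finmap.enum_fset (fset_set F)) depth u.
  have NF u : F u -> (depth u <= N)%N.
    move=> Fu; have uF : u \in finmap.enum_fset (fset_set F).
      by rewrite in_fset_set// inE.
    by rewrite /N (big_rem _ uF)/= leq_maxl.
  have [n Nn Un] :=
    weak_limit_point_frequently (maxn N m).+1 fx (nbhs_weak_coord x v c0).
  exists n; first by rewrite (leq_ltn_trans _ Nn)// leq_maxr.
  apply: contrapT => nl.
  have nF u : F u -> ~ Chin E n v u.
    move=> /NF uN vu.
    have /Chin_unique := ChinD (Hdepth v) vu.
    move=> /(_ hE hr _ (Hdepth u)) du.
    have : (n <= N)%N by rewrite (leq_trans _ uN)// -du leq_addl.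
    by rewrite leqNgt (leq_ltn_trans _ Nn)// leq_maxl.
  (* The restriction of [f] to generation [n] below [v]: same value at [v] after [n] steps, but
     small norm as it vanishes on [F]. *)
  pose g0 u := if `[< Chin E n v u >] then f u else 0.
  have g0f u : weighted mu g0 u <= weighted mu f u.
    rewrite /weighted /g0; case: asboolP => // _.
    by rewrite mul0r modulus0 modulus_ge0.
  have g0X : g0 \in wspace_pred mu X.
    apply/wspace_predP.
    exact: (in_space_le (weighted_ge0 mu g0) g0f (wspaceP f)).
  pose g : W := WSpace g0X.
  have gn : real_norm g <= c / (1 + i%:R).
    apply: HF => [u|u|u /nF vu]; [exact: weighted_ge0|exact: g0f|].
    by rewrite /weighted /= /g0 asboolF// mul0r modulus0.
  have fgE : iter n B f v = iter n B g v.
    have -> : f = (f - g) + g by rewrite subrK.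
    rewrite iter_shiftD wspaceD (iter_shift_eq0 hB) ?add0r// => u vu.
    by rewrite wspaceB /= /g0 asboolT// subrr.
  have := orbit_coord_bound hE hB M1 hM g (ler0n _ _) nl.
  rewrite -fgE leNgt => /negP; apply.
  (* The iterate is within less than [c] of [x v], whose modulus is [2 * c], so its modulus exceeds
     [c]. *)
  apply: (@le_lt_trans _ _ c); first by rewrite mulrC -ler_pdivlMr.
  have : modulus (x v) <= modulus (iter n B f v) + modulus (iter n B f v - x v).
    rewrite -[in X in _ <= _ + X]modulusN opprB.
    by apply: le_trans (modulusD _ _); rewrite addrC subrK.
  rewrite [X in X <= _]splitr -/c => H.
  by rewrite -(ltrD2r c) (le_lt_trans H)// ltrD2l.
exists n, v; split => //; apply/weight_conditionP => C C0.
near=> j; have Cj : C <= j%:R.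
  by near: j; exact: nbhs_infty_ger.
have j0 : (0 < j)%N by near: j; exact: nbhs_infty_gt.
rewrite -(prednK j0); have := nl j.-1.
by apply: large_le; rewrite prednK.
Unshelve. all: by end_near. Qed.

(** If [v] has depth [d], then [Chin E n v] is contained in [Chin E (d + n) r]. *)
Lemma weight_condition_root (n : nat -> nat) (v : V) : increasing_seq n ->
  (forall j, (0 < n j)%N) -> weight_condition mu X (fun j => Chin E (n j) v) ->
  exists n' : nat -> nat, [/\ increasing_seq n', forall j, (0 < n' j)%N &
    weight_condition mu X (fun j => Chin E (n' j) r)].
Proof.
move=> n_incr n_gt0 /weight_conditionP wc.
have [d rv] := root_reaches hE hr v.
exists (fun j => (d + n j)%N); split.
- by move=> i j /=; rewrite -n_incr /= leEnat leq_add2l.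
- by move=> j; rewrite ltn_addl.
apply/weight_conditionP => C C0; apply: filterS (wc C C0) => j.
by apply: large_sub => // u; exact: ChinD rv.
Qed.

Lemma coord_norm_gtP (n : nat -> nat) v :
  weight_condition mu X (fun j => Chin E (n j) v) <->
  forall C, 0 < C -> \forall j \near \oo, coord_norm_gt B (n j) v C.
Proof.
split => [/weight_conditionP wc C C0|H].
  have [C' HC'] := large_coord_norm_gt hE hB C0.
  have C1 : 0 < Num.max C' 1 by rewrite lt_max ltr01 orbT.
  apply: filterS (wc _ C1) => j nl; apply: HC'; apply: large_le nl.
  by rewrite le_max lexx.
apply/weight_conditionP => C C0.
apply: filterS (H (1 + C) _) => [j|]; last by rewrite addr_gt0.
exact: (coord_norm_gt_large hE hB M1 hM (ltW C0)).
Qed.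

(** The new times are [n j - i] for suitable [j]. For [l <= i], adding [l] gives a time at most [i]
    steps before [n j], which costs at most a factor [M ^+ i]. *)
Lemma weight_condition_shifts (n : nat -> nat) v : increasing_seq n ->
  weight_condition mu X (fun j => Chin E (n j) v) ->
  exists n' : nat -> nat, [/\ increasing_seq n', forall j, (0 < n' j)%N &
    forall l, weight_condition mu X (fun j => Chin E (n' j + l) v)].
Proof.
move=> n_incr /coord_norm_gtP wc.
have [|n' [n'_incr n'_gt0 _ Hn']] := @increasing_extraction
    (fun i _ m => forall l, (l <= i)%N -> coord_norm_gt B (m + l) v i%:R).
  move=> i m.
  (* [M ^+ i] absorbs the steps back; [i.+1] instead of [i] keeps the constant positive. *)
  have [|J _ HJ] := wc (i.+1%:R * M ^+ i); first by rewrite mulr_gt0// exprn_gt0.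
  have nj j : (j <= n j)%N := increasing_seq_ge_id j n_incr.
  pose j := (J + (m + i).+1)%N.
  have ij : (m + i < n j)%N by rewrite (leq_trans _ (nj j))// leq_addl.
  exists (n j - i)%N => [|l li]; first by rewrite ltn_subRL addnC.
  apply: (coord_norm_gtD M1 hM (l := i - l)) => //.
  rewrite -addnA subnKC// subnK; last by rewrite (leq_trans _ (ltnW ij))// leq_addl.
  apply: coord_norm_gt_le (HJ j (leq_addr _ _)).
  apply: ler_pM; rewrite ?exprn_ge0// ?ler_nat// ?(ltW M_gt0)//.
  by rewrite ler_weXn2l// leq_subr.
exists n'; split => // l; apply/coord_norm_gtP => C C0.
near=> j; have Cj : C <= j%:R by near: j; exact: nbhs_infty_ger.
have jl : (l < j)%N by near: j; exact: nbhs_infty_gt.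
have j0 : (0 < j)%N by exact: leq_ltn_trans jl.
rewrite -(prednK j0); apply: coord_norm_gt_le (Hn' j.-1 l _).
  by rewrite prednK.
by rewrite prednK// ltnW.
Unshelve. all: by end_near. Qed.

Lemma weight_condition_orbit (n : nat -> nat) : increasing_seq n ->
  weight_condition mu X (fun j => Chin E (n j) r) ->
  exists f : W, limit_point (op_orbit B f) (e_ r).
Proof.
move=> n_incr /weight_conditionP wc.
(* Here [p] is the preceding time: after at most [p] applications of [B], the norm of [h] is still
   at most [2^-1 ^+ i]. *)
have [|m [m_incr m_gt0 [m' Hm'] Hm]] := @increasing_extraction
    (fun i p m => exists h : W, [/\ iter m B h = e_ r,
       forall u, ~ Chin E m r u -> h u = 0 &
       real_norm h <= (M ^+ p)^-1 * 2^-1 ^+ i]).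
  move=> i p.
  have C0 : 0 < M ^+ p * 2 ^+ i by rewrite mulr_gt0// exprn_gt0.
  have [C' HC'] := large_preimage hE hB C0.
  have C1 : 0 < Num.max C' 1 by rewrite lt_max ltr01 orbT.
  have [J _ HJ] := wc _ C1.
  have nj j : (j <= n j)%N := increasing_seq_ge_id j n_incr.
  exists (n (J + p.+1)%N); first by rewrite (leq_trans _ (nj _))// leq_addl.
  have /HC'[h [hr' h0 hC]] : large X y (Chin E (n (J + p.+1)%N) r) C'.
    by apply: large_le (HJ _ (leq_addr _ _)); rewrite le_max lexx.
  exists h; split => //; rewrite exprVn -invfM.
  by rewrite -[leRHS]mul1r ler_pdivlMr// mulrC ltW.
(* The first time has no predecessor, hence the default factor 1, which dominates [(M ^+ m')^-1]. *)
have {}Hm i : exists h : W, [/\ iter (m i) B h = e_ r,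
    forall u, ~ Chin E (m i) r u -> h u = 0 &
    real_norm h <= (if i is j.+1 then (M ^+ m j)^-1 else 1) * 2^-1 ^+ i].
  case: i => [|i]; last exact: Hm.
  have [h [h1 h2 h3]] := Hm'; exists h; split => //; apply: le_trans h3 _.
  by rewrite ler_wpM2r ?expr0// invf_le1 ?exprn_gt0// exprn_ege1.
have {Hm Hm'}[h Hh] := choice Hm.
have h_iter i : iter (m i) B (h i) = e_ r by have [] := Hh i.
have iter_root l : iter l.+1 B (e_ r) = 0.
  by rewrite iterSr (shift_basis_root hB hr) iter_shift0.
(* As [B] kills [e_ r], a vector sent to [e_ r] at an earlier time is sent to 0. This is applied to
   the [h j] with [j < i], and at the end to [f] itself. *)
have iter_later i j (g : W) : iter (m j) B g = e_ r -> (m j < m i)%N ->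
    iter (m i) B g = 0.
  by move=> gr ji; rewrite -(subnK ji) addnS -addSn iterD gr iter_root.
have h_supp i u : ~ Chin E (m i) r u -> h i u = 0 by have [_ + _] := Hh i; apply.
have h_norm i j : real_norm (h (i + j.+1)%N) <= (M ^+ m i)^-1 * 2^-1 ^+ (i + j.+1).
  have [_ _] := Hh (i + j.+1)%N; rewrite addnS => /le_trans; apply.
  rewrite ler_pM2r ?exprn_gt0 ?invr_gt0//.
  rewrite lef_pV2 ?posrE ?exprn_gt0// ler_weXn2l//.
  by have := m_incr i (i + j)%N; rewrite leEnat leq_addr => ->.
have h_norm1 i : real_norm (h i) <= 1 * 2^-1 ^+ i.
  have [_ _] := Hh i => /le_trans; apply.
  rewrite ler_pM2r ?exprn_gt0 ?invr_gt0//; case: i => // i.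
  by rewrite invf_le1 ?exprn_gt0// exprn_ege1.
have mi i : (i <= m i)%N := increasing_seq_ge_id i m_incr.
have [depth Hdepth] := choice (root_reaches hE hr).
(* [h j] lives in generation [m j >= j], so at each vertex the series defining [f] is a finite
   sum. *)
have h_far u j : (depth u < j)%N -> h j u = 0.
  move=> uj; apply: h_supp => /(Chin_unique hE hr (Hdepth u)) du.
  by move: uj; rewrite du ltnNge mi.
pose f0 u := \sum_(j < (depth u).+1) h j u.
have f0E u J : (depth u < J)%N -> f0 u = \sum_(j < J) h j u.
  move=> uJ; rewrite /f0 -!(big_mkord xpredT (fun j => h j u)).
  rewrite [RHS](big_cat_nat _ uJ)//= [X in _ + X]big1_seq ?addr0// => j.
  by rewrite mem_index_iota => /andP[_ /andP[/h_far ->]].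
have w_sum u (I : nat) (g : nat -> W) (t : V -> K) : t u = \sum_(j < I) g j u ->
    weighted mu t u <= \sum_(j < I) weighted mu (g j) u.
  by rewrite /weighted => ->; rewrite mulr_suml; exact: modulus_sum.
have f0X : f0 \in wspace_pred mu X.
  apply/wspace_predP.
  have [] // := space_series ltr01 (fun j => weighted_ge0 mu (h j))
    (fun j => wspaceP (h j)) h_norm1 (weighted_ge0 mu f0) (K := fun u => (depth u).+1).
  by move=> u; exact: w_sum.
pose f : W := WSpace f0X.
have dist_small i : real_norm (iter (m i) B f - e_ r) <= 2^-1 ^+ i.
  (* Under [iter (m i) B] the terms before [h i] vanish and [h i] gives [e_ r]; the tail [g] gives
     the error. *)
  pose g := f - \sum_(j < i.+1) h j.
  have gE u : g u = \sum_(j < (depth u).+1) h (i + j.+1)%N u.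
    rewrite /g wspaceB wspace_sum /= (f0E u (i.+1 + (depth u).+1)%N); last first.
      by rewrite ltn_addl.
    rewrite big_split_ord/= addrAC subrr add0r; apply: eq_bigr => j _.
    by rewrite addSnnS.
  have Mi0 : 0 < (M ^+ m i)^-1 by rewrite invr_gt0 exprn_gt0.
  (* Summing the geometric series doubles this constant and the iterate multiplies it by at most
     [M ^+ m i], which leaves [2^-1 ^+ i]. *)
  have e0 : 0 < (M ^+ m i)^-1 * 2^-1 ^+ i.+1.
    by rewrite mulr_gt0// exprn_gt0// invr_gt0.
  have [j|u|_ gn] := space_series e0 (fun j => weighted_ge0 mu (h (i + j.+1)%N))
    (fun j => wspaceP (h (i + j.+1)%N)) _ (weighted_ge0 mu g)
    (K := fun u => (depth u).+1).
  - apply: le_trans (h_norm i j) _.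
    by rewrite -mulrA -exprD addSnnS.
  - by apply: (w_sum u _ (fun j => h (i + j.+1)%N)); exact: gE.
  have -> : iter (m i) B f - e_ r = iter (m i) B g.
    have -> : f = \sum_(j < i.+1) h j + g by rewrite /g addrC subrK.
    rewrite iter_shiftD iter_shift_sum big_ord_recr/= h_iter big1 ?add0r.
      by rewrite addrC addKr.
    move=> j _; have ji : (m j < m i)%N.
      by rewrite ltnNge; have := m_incr i j; rewrite leEnat => ->; rewrite -ltnNge.
    exact: iter_later.
  apply: le_trans (iter_norm_le M1 hM _ _) _.
  rewrite -ler_pdivlMl ?exprn_gt0//; apply: le_trans gn _.
  by rewrite exprS mulrCA [2 * (2^-1 * _)]mulrA divff// mul1r.
exists f => U /nbhs_ballP[e /= e0 eU].
have norm_e0 : 0 < real_norm (e_ r).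
  apply: (@lt_le_trans _ _ (weighted mu (e_ r) r)).
    by rewrite /weighted basisE eqxx mul1r modulus_weight_gt0.
  by apply: coord_le_norm (wspaceP _) => u; exact: weighted_ge0.
have de0 : 0 < modulus e.
  rewrite lt0r modulus_ge0 andbT; apply/eqP => /modulus_eq0 e00.
  by rewrite e00 ltxx in e0.
(* A limit point needs an iterate different from [e_ r]. If time [m i] gave exactly [e_ r], the next
   one would give 0, at distance [real_norm (e_ r)] from [e_ r]; the second bound in the minimum
   excludes this. *)
have d0 : 0 < Num.min (modulus e) (real_norm (e_ r)) by rewrite lt_min de0.
have [i ie] : exists i, 2^-1 ^+ i < Num.min (modulus e) (real_norm (e_ r)).
  have h1 : `|2^-1 : R| < 1 by rewrite ger0_norm ?invr_ge0// invf_lt1// ltr1n.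
  have [J _ /(_ J (leqnn J))] := (cvgrPdist_lt _ _).1 (cvg_expr h1) _ d0.
  by rewrite sub0r normrN ger0_norm ?exprn_ge0//; exists J.
move: ie; rewrite lt_min => /andP[ie1 ie2].
have in_U j : (i <= j)%N -> U (iter (m j) B f).
  move=> ij; apply: eU; rewrite -ball_normE /= distrC normE.
  rewrite -(ger0_norm (ltW e0)) -of_real_modulus lt_neqAle of_real_le.
  rewrite (inj_eq (@of_real_inj _ k)) -lt_neqAle.
  apply: le_lt_trans (dist_small j) (le_lt_trans _ ie1).
  by rewrite ler_wiXn2l ?invr_ge0 ?invf_le1// ler1n.
have [fi|fi] := eqVneq (iter (m i) B f) (e_ r); last first.
  by exists (iter (m i) B f); split => //; [exists (m i)|exact: in_U].
have fi1 : iter (m i.+1) B f = 0.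
  by apply: iter_later fi _; move/increasing_seqP: m_incr; exact.
have := dist_small i.+1.
rewrite fi1 sub0r -scaleN1r real_normZ modulusN modulus1 mul1r leNgt.
rewrite (le_lt_trans _ ie2)// exprS ler_piMl ?exprn_ge0 ?invr_ge0//.
by rewrite invf_le1// ler1n.
Qed.

End main_implications.

Theorem theorem7p1 (R : realType) (k : scalar_field) (V : countType)
    (E : rel V) (hE : directed_tree E) (r : V) (hr : is_root E r)
    (mu : weight R k V) (X : seq_space R)
    (B : {linear wspace mu X -> wspace mu X})
    (hB : is_backward_shift E B) (hBb : bounded_operator B) :
  [<->
    (exists f x : wspace mu X, x != 0 /\ limit_point (op_orbit B f) x);
    (exists f x : wspace mu X, x != 0 /\ weak_limit_point (op_orbit B f) x);
    (exists f : wspace mu X, limit_point (op_orbit B f) (basis_vec mu X r));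
    (exists f : wspace mu X, weak_limit_point (op_orbit B f) (basis_vec mu X r));
    (exists (n : nat -> nat) (v : V),
       [/\ increasing_seq n, forall j, (0 < n j)%N &
           weight_condition mu X (fun j => Chin E (n j) v)]);
    (exists n : nat -> nat,
       [/\ increasing_seq n, forall j, (0 < n j)%N &
           weight_condition mu X (fun j => Chin E (n j) r)]);
    (exists (n : nat -> nat) (v : V),
       [/\ increasing_seq n, forall j, (0 < n j)%N &
           forall l : nat,
             weight_condition mu X (fun j => Chin E (n j + l) v)])
  ].
Proof.
have [M M1 hM] := real_bound hBb.
have h15 (f x : wspace mu X) : x != 0 -> weak_limit_point (op_orbit B f) x ->
    exists (n : nat -> nat) (v : V), [/\ increasing_seq n,
      forall j, (0 < n j)%N & weight_condition mu X (fun j => Chin E (n j) v)].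
  exact: (weak_limit_point_weight_condition hE hr hB M1 hM).
have h56 : (exists (n : nat -> nat) (v : V), [/\ increasing_seq n,
      forall j, (0 < n j)%N & weight_condition mu X (fun j => Chin E (n j) v)]) ->
    exists n : nat -> nat, [/\ increasing_seq n, forall j, (0 < n j)%N &
      weight_condition mu X (fun j => Chin E (n j) r)].
  by move=> [n [v [n_incr n_gt0 /(weight_condition_root hE hr n_incr n_gt0)]]].
have h63 : (exists n : nat -> nat, [/\ increasing_seq n, forall j, (0 < n j)%N &
      weight_condition mu X (fun j => Chin E (n j) r)]) ->
    exists f : wspace mu X, limit_point (op_orbit B f) (basis_vec mu X r).
  by move=> [n [n_incr _ /(weight_condition_orbit hE hr hB M1 hM n_incr)]].
have er0 : basis_vec mu X r != 0.
  apply/eqP => /(congr1 (fun f : wspace mu X => f r)) /eqP.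
  by rewrite basisE eqxx oner_eq0.
(* The cycle runs through the conditions in their order: (2) reaches (3) by way of (5) and (6), and
   (7) with [l = 0] returns to (1) by way of (5), (6) and (3). *)
tfae.
- by move=> [f [x [x0 /limit_point_weak fx]]]; exists f, x.
- by move=> [f [x [x0 fx]]]; apply/h63/h56/(h15 f x).
- by move=> [f /limit_point_weak fr]; exists f.
- by move=> [f fr]; exact: (h15 f _ er0 fr).
- exact: h56.
- move=> [n [n_incr _ wc]].
  by have [n' ?] := weight_condition_shifts hE hB M1 hM n_incr wc; exists n', r.
- move=> [n [v [n_incr n_gt0 wc]]].
  have [|f fr] := h63; last by exists f, (basis_vec mu X r).
  apply: h56; exists n, v; split => //; have := wc 0%N.
  by under eq_fun do rewrite addn0.
Qed.
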